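(* Let $d_1\le d_2$ be positive integers, and let $F(t,z)=\dfrac{1}{(tz^{d_2-d_1},z^2)_{d_1+1}\,(t,z^2)_{d_2+1}}$. The Poincaré series $\mathcal{PS}_{d_1,d_2}(z)$ of the algebra of joint semi-invariants (equivalently, joint covariants) is obtained by replacing the factor $1-z^2$ with $1+z$ in the formulas for the Poincaré series of the algebra of joint invariants; that is: (a) If $d_2>d_1$ and $d_2-d_1\equiv 1\pmod 2$, then $$\mathcal{PS}_{d_1,d_2}(z)=\sum_{d_1/2\le k\le d_1}\varphi_{2k-d_1}\bigl((1+z)A_k(z)\bigr)+\sum_{k=0}^{[d_2/2]}\varphi_{d_2-2k}\bigl((1+z)B_k(z)\bigr),$$ where $$A_k(z)=\frac{(-1)^{k}\,z^{(d_1-k)(d_1-k+1)+(d_2+1)(d_1-2k)}}{(z^2,z^2)_{k}\,(z^2,z^2)_{d_1-k}\,(z^{(d_1+d_2)-2k},z^2)_{d_2+1}},$$ $$B_k(z)=\begin{cases}\dfrac{(-1)^k z^{k(k+1)}}{(z^{d_2-d_1-2k},z^2)_{d_1+1}\,(z^2,z^2)_k\,(z^2,z^2)_{d_2-k}}, & 2k<d_2-d_1,\\[3ex] \dfrac{(-1)^{\frac{d_2-d_1+1}{2}}\, z^{k(k+2)-\frac12(d_2-d_1+1)}}{(z,z^2)_{s+1}\,(z,z^2)_{d_1-s}\,(z,z^2)_k\,(z^2,z^2)_{d_2-k}}, & 2k>d_2-d_1,\ \ s=\dfrac{2k-(d_2-d_1)-1}{2}.\end{cases}$$ (b) If $d_2>d_1$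 and $d_1\equiv d_2\pmod 2$, then $$\begin{aligned}\mathcal{PS}_{d_1,d_2}(z)={}&\sum_{d_1/2\le k\le d_1}\varphi_{2k-d_1}\bigl((1+z)A_k(z)\bigr)+\sum_{d_1/2\le k\le d_1}\Bigl(z\,\varphi_{2k-d_1}\bigl((1+z)B_k(z)\bigr)\Bigr)'_z\\&+\sum_{0\le 2k\le d_2-d_1-2}\varphi_{d_2-2k}\bigl((1+z)C_k(z)\bigr)+\sum_{d_1+d_2+2\le 2k\le 2d_2}\varphi_{d_2-2k}\bigl((1+z)C_k(z)\bigr),\end{aligned}$$ where $A_k(z)=-\frac{1}{z^{d_2+d_1-2k}}\lim_{t\to z^{2k-(d_1+d_2)}}\bigl(F(t,z)(1-tz^{d_2+d_1-2k})^2\bigr)'_t$, $B_k(z)=\lim_{t\to z^{2k-(d_1+d_2)}}F(t,z)(1-tz^{d_2+d_1-2k})^2$ and $C_k(z)=\lim_{t\to z^{-2k}}F(t,z)(1-tz^{2k})$. (c) If $d_1=d_2=d$, then $$\mathcal{PS}_{d,d}(z)=\sum_{0\le k\le d/2}\varphi_{d-2k}\bigl((1+z)A_k(z)\bigr)+\sum_{0\le k\le d/2}\Bigl(z\,\varphi_{d-2k}\bigl((1+z)B_k(z)\bigr)\Bigr)'_z,$$ where $A_k(z)=-\frac{1}{z^{2k}}\lim_{t\to z^{-2k}}\bigl(F(t,z)(1-tz^{2k})^2\bigr)'_t$ and $B_k(z)=\lim_{t\to z^{-2k}}F(t,z)(1-tz^{2k})^2$.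
   Context: All vector spaces are over $\mathbb{C}$. $V_d=\langle v_0,\dots,v_d\rangle$ is the $(d+1)$-dimensional irreducible $\mathfrak{sl}_2$-module on which $\begin{pmatrix}0&1\\0&0\end{pmatrix}$ and $\begin{pmatrix}0&0\\1&0\end{pmatrix}$ act by $D_1(v_i)=i\,v_{i-1}$ and $D_2(v_i)=(d-i)v_{i+1}$, extended as derivations to the symmetric algebra $S(V_{d_1}\oplus V_{d_2})$. The algebra of joint invariants of two binary forms of degrees $d_1,d_2$ is the common kernel of $D_1$ and $D_2$ in $S(V_{d_1}\oplus V_{d_2})$. The algebra of joint semi-invariants (isomorphic to the algebra of joint covariants of the two forms) is $\mathcal{S}_{d_1,d_2}=\{v\in S(V_{d_1}\oplus V_{d_2}) : D_1(v)=0\}$, graded by degree in $S(V_{d_1}\oplus V_{d_2})$, and $\mathcal{PS}_{d_1,d_2}(z)=\sum_{n\ge0}\dim\bigl((\mathcal{S}_{d_1,d_2})_n\bigr)z^n$. $\varphi_n$ is the linear map $\varphi_n\bigl(\sum_{i\ge0}a_iz^i\bigr)=\sum_{i\ge0}a_{in}z^i$ on $\mathbb{C}[[z]]$; rational functions of $z$ are identified with their expansions at $z=0$, and the same formula is applied when negative powers of $z$ occur in the expansion or when $n<0$, coefficients that do not occur being $0$. $(\cdot)'_z$ and $(\cdot)'_t$ are derivatives in $z$ and $t$. Notation: $(a,q)_n=(1-a)(1-aq)\cdots(1-aq^{n-1})$, $(a,q)_0=1$; $[x]$ is the integer part of $x$. The limits are taken after cancelling the factors vanishing at the given value of $t$.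
   Formalization: In (a), A_k has (z^{d1-d2-2k},z^2)_{d2+1} for (z^{d1+d2-2k},z^2)_{d2+1}; B_k for 2k>d2-d1 has numerator (-1)^{(d2-d1-1)/2} z^{k(k+1)+(s+1)^2} and (z^2,z^2)_k for (z,z^2)_k. As printed, (a) fails for d1=1, d2=2. *)

(* Defs.v *)
From HB Require Import structures.
From mathcomp Require Import all_boot all_order all_algebra.
From mathcomp Require Import fraction generic_quotient mpoly.
From mathcomp Require Import reals complex ring.

Set Implicit Arguments.
Unset Strict Implicit.
Unset Printing Implicit Defensive.

Import GRing.Theory.
Local Open Scope ring_scope.

Section SemiInvariants.
Variable F : fieldType.

(* S(V_d1 (+) V_d2) is {mpoly F[d1.+1 + d2.+1]}: the variable lshift i stands  *)
(* for the basis vector v_i of V_d1 and rshift j for the vector v_j of V_d2.   *)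
Notation S d1 d2 := {mpoly F[d1.+1 + d2.+1]}.

(* v_i |-> i v_(i-1) on each summand; for i = 0 the scalar vanishes and the    *)
(* index i.-1 is irrelevant.                                                   *)
Definition D1gen d1 d2 (l : 'I_(d1.+1 + d2.+1)) : S d1 d2 :=
  match split l with
  | inl i => i%:R *: 'X_(lshift d2.+1 (inord i.-1 : 'I_d1.+1))
  | inr j => j%:R *: 'X_(rshift d1.+1 (inord j.-1 : 'I_d2.+1))
  end.

Definition D1 d1 d2 (p : S d1 d2) : S d1 d2 :=
  \sum_l D1gen l * p^`M(l).

Lemma D1_X d1 d2 l : D1 ('X_l : S d1 d2) = D1gen l.
Proof.
rewrite /D1 (bigD1 l) //= big1 ?addr0 => [|i il].
  rewrite mderivX mnm1E eqxx scale1r (_ : (_ - _)%MM = 0%MM) ?mpolyX0 ?mulr1 //.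
  by apply/mnmP=> i; rewrite mnmBE subnn mnm0E.
by rewrite mderivX mnm1E eq_sym (negPf il) scale0r mulr0.
Qed.

Lemma D1_derivation d1 d2 (p q : S d1 d2) : D1 (p * q) = D1 p * q + p * D1 q.
Proof.
rewrite /D1 mulr_suml mulr_sumr -big_split; apply: eq_bigr => l _ /=.
by rewrite mderivM mulrDr !mulrA (mulrC p).
Qed.

Lemma D1_linear d1 d2 : linear (@D1 d1 d2).
Proof.
move=> c p q; rewrite /D1 scaler_sumr -big_split; apply: eq_bigr => l _ /=.
by rewrite linearP mulrDr -scalerAr.
Qed.

HB.instance Definition _ d1 d2 :=
  GRing.isLinear.Build F (S d1 d2) (S d1 d2) _ (@D1 d1 d2) (@D1_linear d1 d2).

Lemma D1gen_homog d1 d2 (l : 'I_(d1.+1 + d2.+1)) : D1gen l \is 1.-homog.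
Proof.
by rewrite /D1gen; case: split => i; apply: rpredZ; rewrite dhomogX /= mdeg1.
Qed.

Lemma D1_homog d1 d2 n (p : S d1 d2) : p \is n.-homog -> D1 p \is n.-homog.
Proof.
move=> /dhomogP hp; rewrite [p]mpolyE linear_sum big_seq.
apply: rpred_sum => m /hp mn; rewrite linearZ; apply: rpredZ => /=.
apply: rpred_sum => l _; rewrite mderivX; have [->|ml] := eqVneq (m l) 0%N.
  by rewrite scale0r mulr0 rpred0.
have Ulm : (U_(l) <= m)%MM.
  by apply/mnm_lepP => i; rewrite mnm1E; case: eqP => // <-; rewrite lt0n.
have -> : n = (1 + mdeg (m - U_(l)))%N.
  rewrite -[LHS]mn /= -[in LHS](submK Ulm).
  by rewrite mfD /= mdeg1 addnC.
apply: (dhomogM (D1gen_homog l)).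
apply: (rpredZ (m l)%:R); have := dhomogX F mdeg (mdeg (m - U_(l))%MM) (m - U_(l))%MM.
by rewrite eqxx.
Qed.

Definition D1_deg d1 d2 n (p : dhomog (d1.+1 + d2.+1) F n) :
    dhomog (d1.+1 + d2.+1) F n :=
  DHomog (D1_homog (valP p)).

Definition semi_invariants d1 d2 n : {vspace dhomog (d1.+1 + d2.+1) F n} :=
  lker (linfun (@D1_deg d1 d2 n)).

Lemma mem_semi_invariants d1 d2 n (p : dhomog (d1.+1 + d2.+1) F n) :
  (p \in semi_invariants d1 d2 n) = (D1 (p : S d1 d2) == 0).
Proof.
have lin : linear (@D1_deg d1 d2 n).
  by move=> c q r; apply: val_inj; rewrite /= D1_linear.
pose L := GRing.isLinear.Build F _ _ _ _ lin.
pose f : {linear _ -> _} := HB.pack (@D1_deg d1 d2 n) L.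
by rewrite memv_ker (lfunE f) -val_eqE.
Qed.

Definition PS d1 d2 : nat -> F := fun n => (\dim (semi_invariants d1 d2 n))%:R.

End SemiInvariants.

Notation ratfun F := {fraction {poly F}}.
Local Notation "p %:F" := (@FracField.tofrac _ p) (at level 1, format "p %:F").

Section RationalFunctions.
Variable F : fieldType.
Implicit Types (f : ratfun F) (p q : {poly F}) (a : F).

Definition numer f : {poly F} := \n_(repr f).
Definition denom f : {poly F} := \d_(repr f).

Definition rat_deriv f : ratfun F :=
  ((numer f)^`() * denom f - numer f * (denom f)^`())%:F / (denom f ^+ 2)%:F.

(* Value at a once the common factors of numerator and denominator are gone.   *)
Definition rat_lim f a : F :=
  let g := gcdp (numer f) (denom f) in
  (numer f %/ g).[a] / (denom f %/ g).[a].

(* Coefficient of z^n in p / q, where q(0) <> 0, read off the geometric series *)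
(* p / q = q(0)^-1 p \sum_j (1 - q / q(0))^j.                                  *)
Definition taylor_coef p q (n : nat) : F :=
  ((q`_0)^-1 *: p * \sum_(j < n.+1) (1 - (q`_0)^-1 *: q) ^+ j)`_n.

(* Coefficient of z^m in the Laurent expansion at z = 0: if f = p / (z^v q)    *)
(* with q(0) <> 0, it is the coefficient of z^(m + v) in p / q.                *)
Definition laurent f (m : int) : F :=
  let v := mup 0 (denom f) in
  if m + v%:Z is Posz n then taylor_coef (numer f) (denom f %/ 'X^v) n else 0.

Lemma denom_neq0 f : denom f != 0.
Proof. exact: denom_ratioP. Qed.

Lemma numer_denom f : f = (numer f)%:F / (denom f)%:F.
Proof.
apply/(canRL (mulfK _)); rewrite ?tofrac_eq0 ?denom_neq0 //.
rewrite -[in LHS](reprK f); unlock FracField.tofrac; rewrite -[LHS]FracField.pi_mul.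
apply/eqmodP; rewrite /= FracField.equivfE /FracField.mulf.
by rewrite !numden_Ratio ?mulr1 ?reprK ?oner_neq0 ?denom_ratioP // mulrC.
Qed.

Lemma cross_mul f p q : q != 0 -> f = p%:F / q%:F ->
  numer f * q = p * denom f.
Proof.
move=> q0 /eqP; rewrite {1}[f]numer_denom eqr_div ?tofrac_eq0 ?denom_neq0 //.
by rewrite -!tofracM tofrac_eq => /eqP.
Qed.

Lemma rat_derivE p q : q != 0 ->
  rat_deriv (p%:F / q%:F) = (p^`() * q - p * q^`())%:F / (q ^+ 2)%:F.
Proof.
move=> q0; set f := _ / _; have d0 := denom_neq0 f.
have E := cross_mul q0 (erefl f).
apply/eqP; rewrite /rat_deriv eqr_div ?tofrac_eq0 ?expf_neq0 //.
rewrite -!tofracM tofrac_eq; have /(congr1 (@deriv _)) := E.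
rewrite !derivM; set a := numer f in E *; set b := denom f in E d0 *.
move=> E'; rewrite -subr_eq0; apply/eqP.
transitivity (b * q * ((a^`() * q + a * q^`()) - (p^`() * b + p * b^`()))
              - (b^`() * q + b * q^`()) * (a * q - p * b)); first by ring.
by rewrite E' E !subrr !mulr0 subrr.
Qed.

Lemma rat_limE p q a : q.[a] != 0 -> rat_lim (p%:F / q%:F) a = p.[a] / q.[a].
Proof.
move=> qa; have q0 : q != 0 by apply: contraNneq qa => ->; rewrite horner0.
have E := cross_mul q0 (erefl (p%:F / q%:F)); rewrite /rat_lim.
set f := _ / _ in E *; set g := gcdp _ _; have d0 := denom_neq0 f.
have g0 : g != 0 by rewrite gcdp_eq0 negb_and d0 orbT.
have Ea : numer f %/ g * g = numer f by rewrite divpK ?dvdp_gcdl.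
have Eb : denom f %/ g * g = denom f by rewrite divpK ?dvdp_gcdr.
move: E; rewrite -[in LHS]Ea -[in RHS]Eb mulrAC mulrA => /(mulIf g0) E.
have cop : coprimep (denom f %/ g) (numer f %/ g).
  by rewrite coprimep_sym coprimep_div_gcd // d0 orbT.
have : denom f %/ g %| q.
  by rewrite -(Gauss_dvdpr _ cop) E dvdp_mull.
case/dvdpP=> r Er; have ba : (denom f %/ g).[a] != 0.
  by apply: contraNneq qa => b0; rewrite Er hornerM b0 mulr0.
apply/eqP; rewrite eqr_div // -!hornerM E.
by [].
Qed.

Lemma coef_dvdXn p n k : 'X^n %| p -> (k < n)%N -> p`_k = 0.
Proof. by case/dvdpP=> r -> kn; rewrite coefMXn kn. Qed.

Definition trunc_quot p q N : {poly F} :=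
  (q`_0)^-1 *: p * \sum_(j < N.+1) (1 - (q`_0)^-1 *: q) ^+ j.

Lemma dvdX_geom q : q`_0 != 0 -> 'X %| 1 - (q`_0)^-1 *: q.
Proof.
move=> q0; rewrite -['X]subr0 -polyC0 dvdp_XsubCl /root horner_coef0.
by rewrite coefB coef1 coefZ mulVf ?subrr.
Qed.

Lemma taylor_coef_trunc p q N k : q`_0 != 0 -> (k <= N)%N ->
  taylor_coef p q k = (trunc_quot p q N)`_k.
Proof.
move=> /dvdX_geom uE kN; rewrite /taylor_coef /trunc_quot; set u := 1 - _ in uE *.
rewrite !mulr_sumr !coef_sum.
rewrite [RHS](bigID (fun j : 'I_N.+1 => (j < k.+1)%N)) /= [X in _ + X]big1.
  by rewrite addr0 [LHS](big_ord_widen N.+1 (fun j => (_ * u ^+ j)`_k)).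
move=> j; rewrite -leqNgt => kj; apply: coef_dvdXn kj.
by rewrite dvdp_mull // dvdp_exp2r.
Qed.

Lemma trunc_quotP p q N : q`_0 != 0 -> 'X^(N.+1) %| q * trunc_quot p q N - p.
Proof.
move=> q0; have := dvdX_geom q0; rewrite /trunc_quot; set u := 1 - _ => uE.
have {1}-> : q = q`_0 *: (1 - u) by rewrite subKr scalerA mulfV ?scale1r.
have geo : (1 - u) * \sum_(j < N.+1) u ^+ j = 1 - u ^+ N.+1.
  by rewrite -opprB mulNr -subrX1 opprB.
rewrite -!scalerAl [(1 - u) * _]mulrC -scalerAl scalerA mulfV // scale1r.
rewrite -mulrA [_ * (1 - u)]mulrC geo mulrBr mulr1 addrAC subrr sub0r.
by rewrite dvdpNr dvdp_mull // dvdp_exp2r.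
Qed.

Lemma taylor_coefE p q n : q`_0 != 0 ->
  \sum_(i < n.+1) q`_i * taylor_coef p q (n - i) = p`_n.
Proof.
move=> q0; have /coef_dvdXn/(_ (ltnSn n)) := trunc_quotP p n q0.
move/eqP; rewrite coefB subr_eq0 coefM => /eqP <-.
by apply: eq_bigr => i _; rewrite (taylor_coef_trunc _ q0 (leq_subr i n)).
Qed.

Lemma taylor_coef_mul (r p q : {poly F}) n : r`_0 != 0 -> q`_0 != 0 ->
  taylor_coef (r * p) (r * q) n = taylor_coef p q n.
Proof.
move=> r0 q0; have rq0 : (r * q)`_0 != 0.
  by rewrite coefM big_ord1 mulf_neq0.
rewrite !(taylor_coef_trunc _ _ (leqnn n)) //; apply/eqP; rewrite -subr_eq0 -coefB.
apply/eqP/(coef_dvdXn (n := n.+1)) => //.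
have cop : coprimep 'X^(n.+1) (r * q).
  rewrite coprimep_expl // -['X]subr0 -polyC0 coprimep_sym coprimep_XsubC.
  by rewrite /root horner_coef0.
rewrite -(Gauss_dvdpr _ cop) mulrBr.
have -> : forall a b : {poly F}, a - b = (a - r * p) - (b - r * p).
  by move=> a b; rewrite opprB addrA subrK.
rewrite dvdp_sub ?trunc_quotP // -mulrA -mulrBr dvdp_mull // trunc_quotP //.
Qed.

Lemma taylor_coef_shift p q v n : q`_0 != 0 ->
  taylor_coef (p * 'X^v) q n = if (n < v)%N then 0 else taylor_coef p q (n - v).
Proof.
move=> q0; rewrite (taylor_coef_trunc _ q0 (leqnn n)) /trunc_quot.
rewrite scalerAl mulrAC coefMXn; case: ltnP => // vn.
by rewrite (taylor_coef_trunc _ q0 (leq_subr v n)).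
Qed.

Lemma laurentE p q v m : q`_0 != 0 ->
  laurent (p%:F / (q * 'X^v)%:F) m =
  if m + v%:Z is Posz n then taylor_coef p q n else 0.
Proof.
move=> q0; have qX0 : q * 'X^v != 0.
  rewrite mulf_neq0 ?expf_neq0 ?polyX_eq0 //.
  by apply: contraNneq q0 => ->; rewrite coef0.
rewrite /laurent; set f := _ / _; have E := cross_mul qX0 (erefl f).
move: (numer f) (denom f) (denom_neq0 f) E => a b b0; set w := mup 0 b.
have bE : b %/ 'X^w * 'X^w = b.
  by rewrite divpK //; have := leqnn w; rewrite mup_geq // subr0.
have c0 : (b %/ 'X^w)`_0 != 0.
  apply: contraTneq (leqnn w) => c0; rewrite -ltnNge mup_geq // subr0 exprSr -bE.
  rewrite mulrC dvdp_mul2r ?expf_neq0 ?polyX_eq0 //.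
  by rewrite -[X in X %| _]subr0 -polyC0 dvdp_XsubCl /root horner_coef0 c0.
move: (b %/ _) bE c0 => c <- c0 E.
have H N : taylor_coef (a * 'X^v) c N = taylor_coef (p * 'X^w) q N.
  rewrite -(taylor_coef_mul _ _ q0 c0) -[RHS](taylor_coef_mul _ _ c0 q0).
  by rewrite (mulrC c q) mulrCA E mulrCA.
case mw: (m + w%:Z) => [k|k].
  have := H (k + v)%N; rewrite !taylor_coef_shift // ltnNge leq_addl addnK /= => ->.
  have -> : m + v%:Z = (k + v)%:Z - w%:Z by rewrite PoszD -mw addrAC addrK.
  case: ltnP => kw; last by rewrite subzn.
  by rewrite -opprB subzn ?(ltnW kw) // -(prednK (n := w - _)) ?subn_gt0.
case mv: (m + v%:Z) => [n|//]; have := H (n + w)%N.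
rewrite !taylor_coef_shift // [in RHS]ltnNge leq_addl addnK /= => <-.
suff -> : (n + w < v)%N by [].
rewrite -ltz_nat PoszD -mv addrAC mw -[X in (_ < X)%R]add0r Num.Theory.ltrD2r.
by [].
Qed.

End RationalFunctions.

(* Power series are sequences of coefficients nat -> F, Laurent series are     *)
(* families int -> F.                                                          *)
Section Series.
Variable F : fieldType.

Definition phi (n : int) (a : int -> F) : nat -> F := fun i => a (i%:Z * n).

Definition ser_mulz (a : nat -> F) : nat -> F :=
  fun i => if i is j.+1 then a j else 0.

Definition ser_deriv (a : nat -> F) : nat -> F := fun i => i.+1%:R * a i.+1.

End Series.

Definition qpoch (K : fieldType) (a q : K) (n : nat) : K :=
  \prod_(i < n) (1 - a * q ^+ i).

Section Formulas.
Variable F : fieldType.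

Definition zvar : ratfun F := 'X%:F.
Local Notation z := zvar.

(* F(t, z) is a rational function of t over the field of rational functions of *)
(* z; zpow e is the constant z^e there.                                        *)
Definition tvar : ratfun (ratfun F) := 'X%:F.
Definition zpow (e : int) : ratfun (ratfun F) := ((z ^ e)%:P)%:F.
Local Notation t := tvar.

Definition Ftz (d1 d2 : nat) : ratfun (ratfun F) :=
  (qpoch (t * zpow (d2%:Z - d1%:Z)) (zpow 2) d1.+1
   * qpoch t (zpow 2) d2.+1)^-1.

(* phi_n((1 + z) f) *)
Definition phi1z (n : int) (f : ratfun F) : nat -> F :=
  phi n (laurent ((1 + z) * f)).

(* For d2 - d1 odd all poles of F in t are simple; Aodd d1 d2 k is the value   *)
(* of F(t, z)(1 - t z^(d1 + d2 - 2k)) at t = z^(2k - d1 - d2), and Bodd d1 d2 k *)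
(* that of F(t, z)(1 - t z^(2k)) at t = z^(-2k), in closed form.               *)
(* Two closed forms in the source are misprinted and are corrected here.  In   *)
(* Aodd the source has (z^(d1+d2-2k), z^2)_(d2+1) for                          *)
(* (z^(d1-d2-2k), z^2)_(d2+1).  In the case 2k > d2 - d1 of Bodd it has        *)
(* (-1)^((d2-d1+1)/2) z^(k(k+2)-(d2-d1+1)/2) as numerator and (z, z^2)_k as    *)
(* third factor of the denominator.  As printed the theorem is false: for      *)
(* d1 = 1, d2 = 2 the right-hand side would have constant term -4.             *)
Definition Aodd (d1 d2 k : nat) : ratfun F :=
  let e1 := d1%:Z in let e2 := d2%:Z in let l := k%:Z in
  (-1) ^+ k * z ^ ((e1 - l) * (e1 - l + 1) + (e2 + 1) * (e1 - 2 * l))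
  / (qpoch (z ^+ 2) (z ^+ 2) k * qpoch (z ^+ 2) (z ^+ 2) (d1 - k)
     * qpoch (z ^ (e1 - e2 - 2 * l)) (z ^+ 2) d2.+1).

Definition Bodd (d1 d2 k : nat) : ratfun F :=
  if (2 * k < d2 - d1)%N then
    (-1) ^+ k * z ^+ (k * (k + 1))
    / (qpoch (z ^+ (d2 - d1 - 2 * k)) (z ^+ 2) d1.+1
       * qpoch (z ^+ 2) (z ^+ 2) k * qpoch (z ^+ 2) (z ^+ 2) (d2 - k))
  else
    let s := ((2 * k - (d2 - d1) - 1) %/ 2)%N in
    (-1) ^+ ((d2 - d1 - 1) %/ 2)%N * z ^+ (k * (k + 1) + (s + 1) ^ 2)
    / (qpoch z (z ^+ 2) s.+1 * qpoch z (z ^+ 2) (d1 - s)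
       * qpoch (z ^+ 2) (z ^+ 2) k * qpoch (z ^+ 2) (z ^+ 2) (d2 - k)).

(* At a double pole t = z^(-m) the principal part of F is                      *)
(* double_A / (1 - t z^m) + double_B / (1 - t z^m)^2.                          *)
Definition double_A (d1 d2 : nat) (m : int) : ratfun F :=
  - (z ^ m)^-1 *
  rat_lim (rat_deriv (Ftz d1 d2 * (1 - t * zpow m) ^+ 2)) (z ^ (- m)).

Definition double_B (d1 d2 : nat) (m : int) : ratfun F :=
  rat_lim (Ftz d1 d2 * (1 - t * zpow m) ^+ 2) (z ^ (- m)).

Definition simple_C (d1 d2 : nat) (m : int) : ratfun F :=
  rat_lim (Ftz d1 d2 * (1 - t * zpow m)) (z ^ (- m)).

End Formulas.

(* Main.v *)
(* On the weight spaces of the degree n part of S(V_d1 + V_d2), D1 is         *)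
(* injective in negative weights and surjective onto positive weights, so the *)
(* semi-invariants of degree n are as many as the monomials of degree n and   *)
(* weight 0 or 1.  A monomial of weight w contributes t^n z^(n d2 - w) to     *)
(* F(t, z), hence this number is the coefficient of z^(n d2) in (1 + z) h_n,  *)
(* where h_n is the coefficient of t^n in F(t, z).                            *)
(*   Expand F(t, z) in partial fractions in t over the rational functions of  *)
(* z.  The principal part A / (1 - t z^e) + B / (1 - t z^e)^2 at t = z^(-e)   *)
(* contributes (A + (n + 1) B) z^(n e) to h_n, and so the coefficient of      *)
(* z^(n (d2 - e)) in (1 + z) (A + (n + 1) B) to the count.  The poles with    *)
(* e > d2 contribute nothing because there A and B vanish at z = 0.           *)

Require Import Defs.
From HB Require Import structures.
From mathcomp Require Import all_boot all_order all_algebra.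
From mathcomp Require Import mpoly fraction zify ring reals complex.

Set Implicit Arguments.
Unset Strict Implicit.
Unset Printing Implicit Defensive.

Import Order.TTheory GRing.Theory Num.Theory.
Local Open Scope ring_scope.

(** * Highest weight vectors *)

(** Two facts carry the argument outlined in the header: a count of semi-invariants by weights, and
    a partial fraction expansion in t.

    [D1] and the lowering operator [der D2gen] satisfy the sl2 relation ([D1_D2]): their commutator
    multiplies a vector of weight w by w. Weights are bounded in a fixed degree, so both operators
    are nilpotent there. Hence a vector of negative weight killed by [D1] is zero, and every vector
    of positive weight is in the image of [D1] ([E_inj_neg], [E_surj_pos]). Rank-nullity gives
    [dim_semi_invariants], and comparison with the expansion of F(t, z) gives [PS_laurent].

    Each exponent e occurs at most twice among the factors 1 - t z^e, so all poles have order at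
    most 2. [taylor_coef_partial_fractions] then yields one summand per pole ([PS_pole_terms]), and
    those with e > d2 vanish by [pole_term_eq0]. The three cases differ in how the progressions
    d2-d1, ..., d2+d1 and 0, 2, ..., 2 d2 meet. For opposite parities they are disjoint and the
    residues have closed forms ([PS_odd]); for equal parities the first lies in the second
    ([PS_even_lt]); for d1 = d2 they coincide ([PS_diag]). *)

Section SL2.
Variables (F : fieldType) (V : lmodType F) (E D : {linear V -> V}).
Variable W : int -> V -> Prop.
Hypothesis char0 : forall n : nat, n.+1%:R != 0 :> F.
Hypothesis W_lin : forall w c x y, W w x -> W w y -> W w (c *: x + y).
Hypothesis W_E : forall w x, W w x -> W (w + 2) (E x).
Hypothesis W_D : forall w x, W w x -> W (w - 2) (D x).
Hypothesis EDE : forall w x, W w x -> E (D x) = D (E x) + w%:~R *: x.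

Lemma intr_neq0 (w : int) : w != 0 -> w%:~R != 0 :> F.
Proof.
case: w => [[|n]|n] // _; first exact: char0.
by rewrite NegzE mulrNz oppr_eq0 char0.
Qed.

Lemma W_iterE r w x : W w x -> W (w + 2 * r%:Z) (iter r E x).
Proof.
move=> Wx; elim: r => [|r IH] /=; first by rewrite mulr0 addr0.
by have := W_E IH; congr (W _ _); lia.
Qed.

Lemma W_iterD r w x : W w x -> W (w - 2 * r%:Z) (iter r D x).
Proof.
move=> Wx; elim: r => [|r IH] /=; first by rewrite mulr0 subr0.
by have := W_D IH; congr (W _ _); lia.
Qed.

(** Each exchange of D with an E acting on a vector of weight w + 2i adds that weight; summed over i
    = 0, ..., r this is (r + 1)(w + r). *)
Lemma iterE_D r w x : W w x ->
  iter r.+1 E (D x) =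
  D (iter r.+1 E x) + (r.+1%:Z * (w + r%:Z))%:~R *: iter r E x.
Proof.
move=> Wx; elim: r => [|r IH]; first by rewrite /= (EDE Wx) mul1r addr0.
rewrite iterS IH linearD linearZ /= (EDE (W_E (W_iterE r Wx))).
rewrite -addrA -scalerDl -intrD; congr (_ + _ *: _); congr (_%:~R); lia.
Qed.

Lemma E_iterD j w x : W w x -> E x = 0 ->
  E (iter j.+1 D x) = (j.+1%:Z * (w - j%:Z))%:~R *: iter j D x.
Proof.
move=> Wx Ex; elim: j => [|j IH].
  by rewrite /= (EDE Wx) Ex linear0 add0r mul1r subr0.
rewrite iterS (EDE (W_iterD j.+1 Wx)) IH linearZ /= -scalerDl -intrD.
congr (_ *: _); congr (_%:~R); lia.
Qed.

(** By [E_iterD], E maps D^(j+1) x to (j + 1)(w - j) D^j x. The scalar is nonzero for w < 0, so the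
    vanishing of D^(j+1) x descends to D^j x and finally to x. *)
Lemma E_inj_neg j w x : w < 0 -> W w x -> iter j D x = 0 -> E x = 0 -> x = 0.
Proof.
move=> w0 Wx + Ex; elim: j => [//|j IH] Dx; apply: IH.
have /esym/eqP := E_iterD j Wx Ex; rewrite Dx linear0 scaler_eq0.
by rewrite (negPf (intr_neq0 _)) => [/eqP|]; last by lia.
Qed.

(* If E^r x = 0, then E D - r (w + r - 1), which vanishes on the bottom layer  *)
(* of vectors killed by E^r modulo those killed by E^(r-1), lowers r.          *)
Lemma E_surj_pos r w x : 0 < w -> W w x -> iter r E x = 0 ->
  exists2 y, W (w - 2) y & E y = x.
Proof.
move=> w0; elim: r x => [|r IH] x Wx /=.
  (* [W] is only assumed closed under [c *: x + y], so 0 enters weight w - 2 as a difference of two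
     members. *)
  move=> ->; exists (D x - D x); last by rewrite subrr linear0.
  by rewrite -[- D x]scaleN1r [X in W _ X]addrC; apply: W_lin; exact: W_D.
rewrite -iterS => Ex; set c : F := (r.+1%:Z * (w + r%:Z))%:~R.
have c0 : c != 0 by apply: intr_neq0; lia.
have [||y Wy Ey] := IH (E (D x) - c *: x).
- have /W_E := W_D Wx; rewrite subrK => WEDx.
  by rewrite [X in W _ X]addrC -scaleNr; apply: W_lin.
- elim: {IH} r @c {c0} Ex => [|r IH] c Ex.
    by rewrite /= (EDE Wx) [E x]Ex linear0 add0r /c mul1r addr0 subrr.
  have lin k : {morph iter k E : u v / u - v}.
    by move=> u v; elim: k => //= k ->; rewrite linearB.
  have linZ k a : {morph iter k E : u / a *: u}.
    by move=> u; elim: k => //= k ->; rewrite linearZ.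
  rewrite lin linZ -iterSr (iterE_D _ Wx) Ex linear0 add0r.
  by rewrite /c subrr.
(* From E y = E D x - c x, a preimage of x is (D x - y) / c. *)
exists (c^-1 *: (D x) + - c^-1 *: y).
  rewrite [X in W _ X]addrC; apply: W_lin => //; rewrite -[_ *: D x]addr0; apply: W_lin.
    exact: W_D.
  by rewrite -(subrr y) -[- y]scaleN1r [X in W _ X]addrC; apply: W_lin.
rewrite linearD !linearZ /= Ey scaleNr scalerBr scalerA mulVf // scale1r.
by rewrite opprB addrC subrK.
Qed.

End SL2.

(** * Derivations of polynomial rings and weights of monomials *)

Section Derivations.
Variables (F : fieldType) (r : nat).
Implicit Types (g h : 'I_r -> {mpoly F[r]}) (p q : {mpoly F[r]}).
Implicit Types (c : 'I_r -> int) (m : 'X_{1..r}).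

Definition der g p : {mpoly F[r]} := \sum_l g l * p^`M(l).

Lemma der_linear g : linear (der g).
Proof.
move=> a p q; rewrite /der scaler_sumr -big_split; apply: eq_bigr => l _ /=.
by rewrite linearP mulrDr -scalerAr.
Qed.

HB.instance Definition _ g :=
  GRing.isLinear.Build F {mpoly F[r]} {mpoly F[r]} _ (der g) (der_linear g).

Lemma derM g p q : der g (p * q) = der g p * q + p * der g q.
Proof.
rewrite /der mulr_suml mulr_sumr -big_split; apply: eq_bigr => l _ /=.
by rewrite mderivM mulrDr !mulrA (mulrC p).
Qed.

Lemma derX g l : der g 'X_l = g l.
Proof.
rewrite /der (bigD1 l) //= big1 ?addr0 => [|i il].
  rewrite mderivX mnm1E eqxx scale1r (_ : (_ - _)%MM = 0%MM) ?mpolyX0 ?mulr1 //.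
  by apply/mnmP=> i; rewrite mnmBE subnn mnm0E.
by rewrite mderivX mnm1E eq_sym (negPf il) scale0r mulr0.
Qed.

(** A commutator of derivations is a derivation, given by its values on the variables: the
    second-order terms cancel because partial derivatives commute. *)
Lemma der_der g h p :
  der g (der h p) = der h (der g p) + der (fun l => der g (h l) - der h (g l)) p.
Proof.
have E a b : der a (der b p) =
    \sum_l der a (b l) * p^`M(l) + \sum_l \sum_k b l * (a k * p^`M(l)^`M(k)).
  rewrite [der b p]/der linear_sum -big_split; apply: eq_bigr => l _ /=.
  by rewrite derM [der a p^`M(_)]/der mulr_sumr.
rewrite !E [X in _ = _ + X]/der (eq_bigr _ (fun l _ => mulrBl _ _ _)) sumrB.
have -> : \sum_l \sum_k h l * (g k * p^`M(l)^`M(k)) =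
          \sum_l \sum_k g l * (h k * p^`M(l)^`M(k)).
  rewrite exchange_big /=; apply: eq_bigr => k _; apply: eq_bigr => l _.
  by rewrite mderiv_comm mulrCA.
by rewrite [RHS]addrC addrA subrK.
Qed.

Definition wt c m : int := \sum_l c l *+ m l.

Lemma wtD c m1 m2 : wt c (m1 + m2)%MM = wt c m1 + wt c m2.
Proof.
by rewrite /wt -big_split; apply: eq_bigr => l _; rewrite mnmDE mulrnDr.
Qed.

Lemma wt1 c l : wt c U_(l)%MM = c l.
Proof.
rewrite /wt (bigD1 l) //= mnm1E eqxx mulr1n big1 ?addr0 // => k kl.
by rewrite mnm1E eq_sym (negPf kl) mulr0n.
Qed.

Lemma wt_deg m : wt (fun=> 1) m = (mdeg m)%:Z.
Proof.
by rewrite mdegE /wt -[RHS]natz natr_sum; apply: eq_bigr.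
Qed.

(** The derivation trades one variable l for a monomial of [g l], which shifts the weight by delta.
    The predicate [Q] is arbitrary because both weights equal to a value and weights different from
    it have to be followed. *)
Lemma msupp_der c (Q : int -> Prop) g (delta : int) p :
  (forall l, {in msupp (g l), forall m, wt c m = c l + delta}) ->
  {in msupp p, forall m, Q (wt c m)} ->
  {in msupp (der g p), forall m, Q (wt c m - delta)}.
Proof.
move=> gc pQ m; rewrite mcoeff_msupp /der raddf_sum /= => m_neq0.
have [l] : exists l, (g l * p^`M(l))@_m != 0.
  apply/existsP; apply: contraNT m_neq0; rewrite negb_exists => /forallP m0.
  by rewrite big1 // => l _; apply/eqP; have := m0 l; rewrite negbK.
rewrite -mcoeff_msupp => /msuppM_le /allpairsP[[m1 m2] /= [m1g m2p ->]].
rewrite wtD (gc _ _ m1g) addrAC addrK addrC -wt1 -wtD; apply: pQ.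
move: m2p; rewrite !mcoeff_msupp mcoeff_deriv; apply: contraNneq => ->.
by rewrite mul0rn.
Qed.

(** Euler's identity for weighted homogeneous polynomials. *)
Lemma der_eigen c (w : int) p : {in msupp p, forall m, wt c m = w} ->
  der (fun l => (c l)%:~R *: 'X_l) p = w%:~R *: p.
Proof.
move=> pw; rewrite [p in LHS]mpolyE [p in RHS]mpolyE linear_sum scaler_sumr.
apply: eq_big_seq => m /pw <-; rewrite linearZ /= scalerA mulrC -scalerA.
congr (_ *: _); rewrite /der /wt raddf_sum scaler_suml; apply: eq_bigr => l _.
rewrite mderivX -scalerAl -scalerAr scalerA.
rewrite /= -[c l *+ _]mulr_natr natz intrM -pmulrn.
have [->|ml] := eqVneq (m l) 0%N; first by rewrite mulr0 !scale0r.
rewrite -mpolyXD addmC submK //; apply/mnm_lepP => i; rewrite mnm1E.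
by case: eqP => // <-; rewrite lt0n.
Qed.

End Derivations.

(** * Semi-invariants counted by monomials of weight 0 and 1 *)

Section SemiInvariantDimension.
Variables (F : fieldType) (d1 d2 n : nat).
Hypothesis char0 : forall k : nat, k.+1%:R != 0 :> F.
Notation r := (d1.+1 + d2.+1)%N.
Notation S := {mpoly F[r]}.
Implicit Types (p q : S) (m : 'X_{1..r}) (f : {ffun 'I_r -> 'I_n.+1}).

Definition sl2_wt (l : 'I_r) : int :=
  match split l with
  | inl i => d1%:Z - 2 * i%:Z
  | inr j => d2%:Z - 2 * j%:Z
  end.

(** The operator v_i |-> (d - i) v_(i+1); for i = d the scalar vanishes and the value of [inord] is
    irrelevant. *)
Definition D2gen (l : 'I_r) : S :=
  match split l with
  | inl i => (d1 - i)%:R *: 'X_(lshift d2.+1 (inord i.+1 : 'I_d1.+1))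
  | inr j => (d2 - j)%:R *: 'X_(rshift d1.+1 (inord j.+1 : 'I_d2.+1))
  end.

Lemma split_lshift (i : 'I_d1.+1) : split (lshift d2.+1 i) = inl i.
Proof. exact: (unsplitK (inl i)). Qed.

Lemma split_rshift (j : 'I_d2.+1) : split (rshift d1.+1 j) = inr j.
Proof. exact: (unsplitK (inr j)). Qed.

Definition splitE := (split_lshift, split_rshift).

Lemma der_D1gen p : der (@D1gen F d1 d2) p = D1 p. Proof. by []. Qed.

Lemma msupp_gen c (delta : int) k (a : F) (l : 'I_r) :
  (a != 0 -> c k = c l + delta) ->
  {in msupp (a *: 'X_k : S), forall m, wt c m = c l + delta}.
Proof.
have [-> _ m|a0 /(_ isT) <- m /msuppZ_le/mem_msuppXP <-] := eqVneq a 0.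
  by rewrite scale0r msupp0.
exact: wt1.
Qed.

Lemma D1gen_wt l :
  {in msupp (D1gen F l), forall m, wt sl2_wt m = sl2_wt l + 2}.
Proof.
rewrite /D1gen; case: (split_ordP l) => i ->;
  apply: msupp_gen => i0; rewrite /sl2_wt !splitE inordK;
  case: i i0 => [[|i] /= Hi]; rewrite ?eqxx //; lia.
Qed.

Lemma D2gen_wt l : {in msupp (D2gen l), forall m, wt sl2_wt m = sl2_wt l - 2}.
Proof.
rewrite /D2gen; case: (split_ordP l) => i ->.
  apply: msupp_gen => i0; have id : (i < d1)%N.
    by rewrite ltnNge; apply: contraNN i0; rewrite -subn_eq0 => /eqP->.
  by rewrite /sl2_wt !splitE inordK; lia.
apply: msupp_gen => i0; have id : (i < d2)%N.
  by rewrite ltnNge; apply: contraNN i0; rewrite -subn_eq0 => /eqP->.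
by rewrite /sl2_wt !splitE inordK; lia.
Qed.

Lemma D1gen_deg (l : 'I_r) :
  {in msupp (D1gen F l), forall m, wt (fun=> 1) m = 1 + 0}.
Proof.
rewrite /D1gen; case: split => i;
  by apply: (@msupp_gen (fun=> 1) 0 _ _ l) => _; rewrite addr0.
Qed.

Lemma D2gen_deg (l : 'I_r) :
  {in msupp (D2gen l), forall m, wt (fun=> 1) m = 1 + 0}.
Proof.
rewrite /D2gen; case: split => i;
  by apply: (@msupp_gen (fun=> 1) 0 _ _ l) => _; rewrite addr0.
Qed.

(** On v_i this is (d - i)(i + 1) - i(d - i + 1) = d - 2i. At the ends i = d and i = 0 the product
    with an index out of range is zero. *)
Lemma D1_D2gen l :
  D1 (D2gen l) - der D2gen (D1gen F l) = (sl2_wt l)%:~R *: 'X_l.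
Proof.
have C (d : nat) (i : 'I_d.+1) (X : 'I_d.+1 -> S) :
    ((d - i)%:R * (inord i.+1 : 'I_d.+1)%:R)
      *: X (inord (inord i.+1 : 'I_d.+1).-1)
    - (i%:R * (d - (inord i.-1 : 'I_d.+1))%:R)
      *: X (inord (inord i.-1 : 'I_d.+1).+1)
    = (d%:Z - 2 * i%:Z)%:~R *: X i.
  have -> : (d - i)%:R * (inord i.+1 : 'I_d.+1)%:R
      *: X (inord (inord i.+1 : 'I_d.+1).-1) = ((d - i) * i.+1)%:R *: X i.
    have [id|id] := ltnP i d; last first.
      by rewrite (eqP id) mul0n mul0r !scale0r.
    by rewrite inordK // inord_val natrM.
  have -> : i%:R * (d - (inord i.-1 : 'I_d.+1))%:R
      *: X (inord (inord i.-1 : 'I_d.+1).+1) = (i * (d - i.-1))%:R *: X i.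
    have [i0|i0] := posnP i; first by rewrite i0 mul0n mul0r !scale0r.
    rewrite inordK; last by have := ltn_ord i; lia.
    by rewrite prednK // inord_val natrM.
  rewrite -scalerBl [X in X - _]pmulrn [X in _ - X]pmulrn -intrB.
  congr (_%:~R *: _); have := ltn_ord i; nia.
rewrite -der_D1gen [in LHS]/D1gen /D2gen /sl2_wt.
case: (split_ordP l) => i ->; rewrite !linearZ /= !derX /D1gen !splitE.
  by rewrite scalerN !scalerA -(C _ _ (fun j => 'X_(lshift _ j))).
by rewrite scalerN !scalerA -(C _ _ (fun j => 'X_(rshift _ j))).
Qed.

(** The degree is fixed along with the weight because it is what bounds the weights ([wt_bound]) and
    so makes both operators nilpotent. *)
Definition wt_space (w : int) p :=
  {in msupp p, forall m, mdeg m = n /\ wt sl2_wt m = w}.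

Lemma wt_space_lin w a p q :
  wt_space w p -> wt_space w q -> wt_space w (a *: p + q).
Proof.
move=> pw qw m /msuppD_le; rewrite mem_cat.
by case/orP=> [/msuppZ_le/pw|/qw].
Qed.

Lemma wt_space_D1 w p : wt_space w p -> wt_space (w + 2) (D1 p).
Proof.
move=> pw m mp; split.
  have pn : {in msupp p, forall m, (eq^~ n%:Z) (wt (fun=> 1) m)}.
    by move=> m' /pw [<- _]; rewrite wt_deg.
  have := msupp_der (Q := eq^~ n%:Z) D1gen_deg pn mp.
  by rewrite wt_deg subr0 => /eqP; rewrite eqz_nat => /eqP.
have pw' : {in msupp p, forall m, (eq^~ w) (wt sl2_wt m)} by move=> m' /pw [].
have := msupp_der (Q := eq^~ w) D1gen_wt pw' mp => /= <-.
by rewrite subrK.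
Qed.

Lemma wt_space_D2 w p : wt_space w p -> wt_space (w - 2) (der D2gen p).
Proof.
move=> pw m mp; split.
  have pn : {in msupp p, forall m, (eq^~ n%:Z) (wt (fun=> 1) m)}.
    by move=> m' /pw [<- _]; rewrite wt_deg.
  have := msupp_der (Q := eq^~ n%:Z) D2gen_deg pn mp.
  by rewrite wt_deg subr0 => /eqP; rewrite eqz_nat => /eqP.
have pw' : {in msupp p, forall m, (eq^~ w) (wt sl2_wt m)} by move=> m' /pw [].
have := msupp_der (Q := eq^~ w) D2gen_wt pw' mp => /= <-.
by rewrite addrK.
Qed.

Lemma D1_D2 w p : wt_space w p ->
  D1 (der D2gen p) = der D2gen (D1 p) + w%:~R *: p.
Proof.
move=> pw; rewrite -der_D1gen der_der der_D1gen; congr (_ + _).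
rewrite -(der_eigen (c := sl2_wt)) => [|m /pw[]//].
by apply: eq_bigr => l _; rewrite -D1_D2gen.
Qed.

Lemma wt_bound m : `|wt sl2_wt m| <= ((d1 + d2) * mdeg m)%:Z.
Proof.
rewrite /wt mdegE; apply: le_trans (ler_norm_sum _ _ _) _.
rewrite big_distrr /= -[X in _ <= X]natz natr_sum; apply: ler_sum => l _.
rewrite normrMn natrM natz mulr_natr; rewrite lerMn2r; apply/orP; right.
by rewrite /sl2_wt; case: split => i; have := ltn_ord i; lia.
Qed.

Lemma wt_space_eq0 w p :
  ((d1 + d2) * n)%:Z < `|w| -> wt_space w p -> p = 0.
Proof.
move=> wn pw; apply/eqP; rewrite -msupp_eq0.
case E : (msupp p) => [//|m s].
have [|mn mw] := pw m; first by rewrite E mem_head.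
by have := wt_bound m; rewrite mn mw leNgt wn.
Qed.

Lemma D1_inj_neg w p : w < 0 -> wt_space w p -> D1 p = 0 -> p = 0.
Proof.
move=> w0 pw Dp; pose N := ((d1 + d2) * n).+1%N.
apply: (@E_inj_neg F S (@D1 F d1 d2) (der D2gen) wt_space char0
  wt_space_D2 D1_D2 N _ _ w0 pw _ Dp).
have := @W_iterD F S (der D2gen) wt_space wt_space_D2 N _ _ pw.
by apply: wt_space_eq0; rewrite /N; lia.
Qed.

Lemma D1_surj_pos w p : 0 < w -> wt_space w p ->
  exists2 q, wt_space (w - 2) q & D1 q = p.
Proof.
move=> w0 pw; pose N := ((d1 + d2) * n).+1%N.
apply: (@E_surj_pos F S (@D1 F d1 d2) (der D2gen) wt_space char0
  wt_space_lin wt_space_D1 wt_space_D2 D1_D2 N _ _ w0 pw).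
have := @W_iterE F S (@D1 F d1 d2) wt_space wt_space_D1 N _ _ pw.
by apply: wt_space_eq0; rewrite /N; lia.
Qed.

(** [D1] shifts all weights by 2, so it kills each weight component of p separately; a component of
    negative weight is then zero by [D1_inj_neg]. *)
Lemma semi_invariant_wt_ge0 p : p \is n.-homog -> D1 p = 0 ->
  {in msupp p, forall m, 0 <= wt sl2_wt m}.
Proof.
move=> pn Dp m mp; rewrite leNgt; apply/negP=> w0; set w := wt _ m in w0.
pose q : S := \sum_(m' <- msupp p | wt sl2_wt m' == w) p@_m' *: 'X_[m'].
have qE m' : q@_m' = if wt sl2_wt m' == w then p@_m' else 0.
  rewrite /q raddf_sum /=.
  case: ifP => wm'; last first.
    rewrite big1 // => k wk; rewrite mcoeffZ mcoeffX; case: eqP => [km|_].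
      by rewrite -km wk in wm'.
    by rewrite mulr0.
  rewrite [p in RHS]mpolyE raddf_sum big_mkcond; apply: eq_bigr => k _ /=.
  case: ifP => // wk; rewrite mcoeffZ mcoeffX; case: eqP => [km|_].
    by rewrite km wm' in wk.
  by rewrite mulr0.
have qw : wt_space w q.
  move=> m'; rewrite mcoeff_msupp qE; case: ifP => [/eqP wm'|_].
    by rewrite -mcoeff_msupp; have /dhomogP pn' := pn => /pn'.
  by rewrite eqxx.
suff q0 : q = 0.
  have := qE m; rewrite q0 mcoeff0 eqxx => /esym/eqP.
  by rewrite mcoeff_eq0 mp.
apply: (D1_inj_neg w0 qw); apply: msuppnil0.
(* A monomial of [D1 q] has weight w + 2. It also occurs in [D1 (p - q)], which is [- D1 q], yet no
   weight there equals w + 2. *)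
case E : (msupp _) => [//|k s].
have kD : k \in msupp (D1 q) by rewrite E mem_head.
have [_ wk] := wt_space_D1 qw kD; have kDq : k \in msupp (D1 (p - q)).
  by rewrite linearB /= Dp sub0r (perm_mem (msuppN _)).
have pq : {in msupp (p - q), forall m, (fun x => x != w) (wt sl2_wt m)}.
  move=> m'; rewrite mcoeff_msupp mcoeffB qE; case: ifP => [_|/negbT//].
  by rewrite subrr eqxx.
by have := msupp_der (Q := fun x => x != w) D1gen_wt pq kDq; rewrite wk addrK eqxx.
Qed.


Definition mnm_of f : 'X_{1..r} := [multinom (f i : nat) | i < r].

(** Exponents in degree n are at most n, so finite functions into ['I_n.+1] describe all monomials.
    The same functions index the expansion in [taylor_coef_prod_lin]. *)
Definition exponents (P : pred 'X_{1..r}) : {set {ffun 'I_r -> 'I_n.+1}} :=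
  [set f | (mdeg (mnm_of f) == n) && P (mnm_of f)].

Definition monomial f : dhomog r F n := indhomog n 'X_[mnm_of f].

Lemma mnm_of_inj : injective mnm_of.
Proof.
by move=> f g /mnmP fg; apply/ffunP => i; apply: val_inj; have := fg i; rewrite !mnmE.
Qed.

Lemma mnm_ofP m : mdeg m = n -> exists f, mnm_of f = m.
Proof.
move=> mn; exists [ffun i => inord (m i)]; apply/mnmP=> i.
rewrite mnmE ffunE inordK // ltnS -mn mdegE (bigD1 i) //=; exact: leq_addr.
Qed.

Lemma monomialE f : mdeg (mnm_of f) = n -> monomial f = 'X_[mnm_of f] :> S.
Proof. by move=> fn; rewrite /monomial /indhomog insubdK // dhomogX /= fn. Qed.

Definition monomial_span (P : pred 'X_{1..r}) : {vspace dhomog r F n} :=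
  <<[seq monomial f | f in exponents P]>>%VS.

Lemma mem_monomial_span (P : pred 'X_{1..r}) (p : dhomog r F n) :
  {in msupp p, forall m, P m} -> p \in monomial_span P.
Proof.
move=> pP; have pn := valP p; move/dhomogP in pn.
have -> : p = \sum_(m <- msupp p) p@_m *: (indhomog n 'X_[m] : dhomog r F n).
  apply: val_inj; rewrite linear_sum /= {1}[val p]mpolyE.
  apply: eq_big_seq => m mp; congr (_ *: _); rewrite /indhomog insubdK //.
  by rewrite dhomogX; apply/eqP/pn.
rewrite big_seq; apply: rpred_sum => m mp; apply/rpredZ/memv_span.
have [f fm] := mnm_ofP (pn _ mp); apply/imageP; exists f; last by rewrite /monomial fm.
by rewrite inE fm pP // andbT; apply/eqP/pn.
Qed.

Lemma free_monomials (s : seq {ffun 'I_r -> 'I_n.+1}) :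
  uniq s -> {in s, forall f, mdeg (mnm_of f) = n} ->
  free [seq monomial f | f <- s].
Proof.
elim: s => [|f s IH] /=; first by rewrite nil_free.
case/andP=> fs us sn; rewrite free_cons IH ?andbT //; last first.
  by move=> g gs; apply: sn; rewrite inE gs orbT.
apply/negP => fspan; suff : (monomial f : S)@_(mnm_of f) = 0.
  rewrite monomialE ?sn ?mem_head // mcoeffX eqxx => /eqP.
  by rewrite oner_eq0.
(* The coefficient at the first monomial is a linear form that vanishes on the span of the
   others. *)
have coef_lin : linear (fun p : dhomog r F n => (p : S)@_(mnm_of f) : F^o).
  by move=> a p q; rewrite /= raddfD /= mcoeffZ.
pose L := GRing.isLinear.Build F _ _ _ _ coef_lin.
pose c : {linear dhomog r F n -> F^o} :=
  HB.pack (fun p : dhomog r F n => (p : S)@_(mnm_of f) : F^o) L.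
suff /subvP/(_ _ fspan) : (<<[seq monomial g | g <- s]>> <= lker (linfun c))%VS.
  by rewrite memv_ker lfunE => /eqP.
apply/span_subvP => _ /mapP[g gs ->]; rewrite memv_ker lfunE /=.
rewrite monomialE ?sn ?inE ?gs ?orbT // mcoeffX.
case: (mnm_of g =P mnm_of f) => // /mnm_of_inj gf.
by rewrite -gf gs in fs.
Qed.

Lemma dim_monomial_span P : \dim (monomial_span P) = #|exponents P|.
Proof.
rewrite /monomial_span; have := @free_monomials (enum (exponents P)).
rewrite /free => /(_ (enum_uniq _)) H; rewrite (eqP (H _)) ?size_map -?cardE //.
by move=> f; rewrite mem_enum inE => /andP[/eqP].
Qed.

(** The kernel of [D1] lies in the span of the monomials of weight at least 0, and [D1] maps that
    span onto the one of weight at least 2. By rank-nullity the dimension is the difference of the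
    two counts. *)
Lemma dim_semi_invariants :
  \dim (semi_invariants F d1 d2 n) =
  #|exponents (fun m => (wt sl2_wt m == 0) || (wt sl2_wt m == 1))|.
Proof.
have lin : linear (@D1_deg F d1 d2 n).
  by move=> c q q'; apply: val_inj; rewrite /= D1_linear.
pose L := GRing.isLinear.Build F _ _ _ _ lin.
pose D : {linear _ -> _} := HB.pack (@D1_deg F d1 d2 n) L.
have DE (u : dhomog r F n) : linfun (@D1_deg F d1 d2 n) u = D1_deg u by rewrite (lfunE D).
pose P0 m := 0 <= wt sl2_wt m; pose P2 m := 2 <= wt sl2_wt m.
have kerP : (semi_invariants F d1 d2 n <= monomial_span P0)%VS.
  apply/subvP => p; rewrite mem_semi_invariants => /eqP Dp.
  by apply: mem_monomial_span; apply: semi_invariant_wt_ge0 Dp; apply: valP.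
have imP : (linfun (@D1_deg F d1 d2 n) @: monomial_span P0)%VS = monomial_span P2.
  apply/eqP; rewrite eqEsubv; apply/andP; split.
    rewrite limg_span; apply/span_subvP => _ /mapP[_ /imageP[f + ->] ->].
    rewrite inE => /andP[/eqP fn f0]; rewrite DE; apply: mem_monomial_span.
    rewrite /= monomialE //.
    have fw : wt_space (wt sl2_wt (mnm_of f)) ('X_[mnm_of f] : S).
      by move=> _ /mem_msuppXP <-.
    by move=> m /(wt_space_D1 fw) [_]; rewrite /P2 /P0 in f0 * => ->; lia.
  apply/span_subvP => _ /imageP[f + ->]; rewrite inE => /andP[/eqP fn f2].
  have fw : wt_space (wt sl2_wt (mnm_of f)) ('X_[mnm_of f] : S).
    by move=> _ /mem_msuppXP <-.
  have [|q qw Dq] := D1_surj_pos _ fw; first by rewrite /P2 in f2; lia.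
  have qn : q \is n.-homog by apply/dhomogP => m /qw [].
  have -> : monomial f = linfun (@D1_deg F d1 d2 n) (DHomog qn).
    by rewrite DE; apply: val_inj; rewrite /= Dq monomialE.
  apply/memv_img/mem_monomial_span => m /= /qw [_]; rewrite /P0 /P2 in f2 * => ->.
  lia.
have := limg_ker_dim (linfun (@D1_deg F d1 d2 n)) (monomial_span P0).
rewrite imP (capv_idPr kerP) !dim_monomial_span => E.
apply/eqP; rewrite -(eqn_add2r #|exponents P2|) [in X in X == _]E.
rewrite -cardsUI [X in (_ == _ + X)%N](_ : _ = 0%N); last first.
  apply/eqP; rewrite cards_eq0 -subset0; apply/subsetP => f; rewrite !inE /P2.
  by case: eqP => //= _; lia.
rewrite addn0; apply/eqP/eq_card => f; rewrite !inE /P0 /P2.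
by case: eqP => //= _; lia.
Qed.

End SemiInvariantDimension.

(** * Power series and partial fractions *)

Section TaylorCoef.
Variable K : fieldType.
Implicit Types (p q s : {poly K}) (x c : K).

Lemma coprimep_Xn q n : q`_0 != 0 -> coprimep 'X^n q.
Proof.
move=> q0; rewrite coprimep_expl // -['X]subr0 -polyC0 coprimep_sym.
by rewrite coprimep_XsubC /root horner_coef0.
Qed.

(** As q(0) is nonzero, q is invertible modulo X^(n+1), so s and p / q agree up to order n. *)
Lemma taylor_coef_cong p q s n :
  q`_0 != 0 -> 'X^(n.+1) %| q * s - p -> taylor_coef p q n = s`_n.
Proof.
move=> q0 qs; rewrite (taylor_coef_trunc _ q0 (leqnn n)); apply/eqP.
rewrite -subr_eq0 -coefB; apply/eqP/(coef_dvdXn (n := n.+1)) => //.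
rewrite -(Gauss_dvdpr _ (coprimep_Xn n.+1 q0)) mulrBr.
have -> : q * trunc_quot p q n - q * s = (q * trunc_quot p q n - p) - (q * s - p).
  by rewrite opprB addrA subrK.
by rewrite dvdp_sub ?trunc_quotP.
Qed.

Lemma taylor_coefD p p' q n :
  taylor_coef (p + p') q n = taylor_coef p q n + taylor_coef p' q n.
Proof. by rewrite /taylor_coef scalerDr mulrDl coefD. Qed.

Lemma taylor_coefZ c p q n : taylor_coef (c *: p) q n = c * taylor_coef p q n.
Proof. by rewrite /taylor_coef scalerA [_ * c]mulrC -scalerA -scalerAl coefZ. Qed.

Lemma taylor_coef0 q n : taylor_coef 0 q n = 0.
Proof. by rewrite /taylor_coef scaler0 mul0r coef0. Qed.

Lemma taylor_coef_sum (I : Type) (u : seq I) (P : I -> {poly K}) q n :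
  taylor_coef (\sum_(i <- u) P i) q n = \sum_(i <- u) taylor_coef (P i) q n.
Proof.
elim: u => [|i u IH]; first by rewrite !big_nil taylor_coef0.
by rewrite !big_cons taylor_coefD IH.
Qed.

Definition lin x : {poly K} := 1 - x *: 'X.

Definition geom x n : {poly K} := \sum_(j < n.+1) (x *: 'X) ^+ j.

Lemma lin0 x : (lin x)`_0 = 1.
Proof. by rewrite coefB coef1 coefZ coefX mulr0 subr0. Qed.

Lemma lin_horner x y : (lin x).[y] = 1 - x * y.
Proof. by rewrite !hornerE. Qed.

Lemma coef_prod_lin (u : seq K) (P : pred K) : (\prod_(x <- u | P x) lin x)`_0 = 1.
Proof.
elim/big_rec: _ => [|x p _]; first by rewrite coef1.
by rewrite coefM big_ord1 lin0 mul1r.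
Qed.

Lemma lin_geom x n : lin x * geom x n = 1 - (x *: 'X) ^+ n.+1.
Proof. by rewrite -opprB subrX1 -mulNr opprB. Qed.

Lemma lin_geom_dvd x n : 'X^(n.+1) %| lin x * geom x n - 1.
Proof.
by rewrite lin_geom addrAC subrr sub0r dvdpNr exprZn -mul_polyC dvdp_mull.
Qed.

Lemma coef_geom x n i : (geom x n)`_i = if (i <= n)%N then x ^+ i else 0.
Proof.
rewrite coef_sum; case: leqP => ni.
  rewrite (bigD1 (Ordinal (n := n.+1) (m := i) ni)) //= exprZn coefZ coefXn eqxx.
  rewrite mulr1 big1 ?addr0 // => j ji; rewrite exprZn coefZ coefXn.
  case: eqP => [E|_]; last by rewrite mulr0.
  by rewrite -val_eqE /= -E eqxx in ji.
rewrite big1 // => j _; rewrite exprZn coefZ coefXn; case: eqP => [E|]; last by rewrite mulr0.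
by have := ltn_ord j; rewrite -E ltnS leqNgt ni.
Qed.

Lemma taylor_coef_lin c x n : taylor_coef c%:P (lin x) n = c * x ^+ n.
Proof.
rewrite -[c%:P]mulr1 mul_polyC taylor_coefZ.
by rewrite (taylor_coef_cong _ (lin_geom_dvd x n)) ?lin0 ?oner_eq0 // coef_geom leqnn.
Qed.

Lemma taylor_coef_lin2 a b x n :
  taylor_coef (a *: lin x + b%:P) (lin x ^+ 2) n = (a + b *+ n.+1) * x ^+ n.
Proof.
have l0 : (lin x)`_0 != 0 by rewrite lin0 oner_eq0.
have -> : a *: lin x + b%:P = lin x * a%:P + b *: 1.
  by rewrite mulrC -!mul_polyC mulr1.
rewrite taylor_coefD taylor_coef_mul // taylor_coef_lin mulrDl; congr (_ + _).
rewrite taylor_coefZ mulrnAl -mulrnAr; congr (_ * _).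
have d : 'X^(n.+1) %| lin x ^+ 2 * geom x n ^+ 2 - 1.
  rewrite -exprMn -[X in _ - X](expr1n _ 2) subr_sqr dvdp_mulr //.
  exact: lin_geom_dvd.
have l20 : (lin x ^+ 2)`_0 != 0 by rewrite coefM big_ord1 mulf_neq0.
rewrite (taylor_coef_cong l20 d) expr2 coefM (eq_bigr (fun=> x ^+ n)) ?sumr_const ?card_ord // => i _.
by rewrite !coef_geom leq_subr -ltnS ltn_ord -exprD subnKC // -ltnS.
Qed.

(* For x_l = z^(e_l) this is the h_n of the header.                            *)
Lemma taylor_coef_prod_lin r (x : 'I_r -> K) n :
  taylor_coef 1 (\prod_l lin (x l)) n =
  \sum_(f : {ffun 'I_r -> 'I_n.+1} | (\sum_l f l)%N == n)
    \prod_l x l ^+ f l.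
Proof.
have l0 : (\prod_l lin (x l))`_0 = 1.
  elim/big_rec: _ => [|l p _ IH]; first by rewrite coef1.
  by rewrite coefM big_ord1 lin0 mul1r IH.
(* The product of truncated geometric series inverts the denominator modulo X^(n+1); distributing it
   gives one term per exponent function. *)
have d : 'X^(n.+1) %| \prod_l lin (x l) * \prod_l geom (x l) n - 1.
  rewrite -big_split /=; elim/big_rec: _ => [|l p _ IH]; first by rewrite subrr dvdp0.
  rewrite -[_ * p](subrK p) -addrA dvdp_add // -[X in _ - X]mul1r -mulrBl.
  by rewrite dvdp_mulr // lin_geom_dvd.
rewrite (taylor_coef_cong _ d) ?l0 ?oner_eq0 // /geom bigA_distr_bigA /=.
rewrite coef_sum [RHS]big_mkcond; apply: eq_bigr => f _.
rewrite (eq_bigr (fun l => (x l ^+ f l)%:P * 'X^(f l))); last first.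
  by move=> l _; rewrite exprZn mul_polyC.
rewrite big_split /= prodrXr -rmorph_prod mul_polyC coefZ coefXn eq_sym.
by case: (_ == _); rewrite ?mulr1 ?mulr0.
Qed.

End TaylorCoef.

(** The logarithmic derivative turns the product into a sum, whose terms can be checked one by one
    for regularity at z = 0 in [cofac_logderiv_regular0]. *)
Lemma logderiv_prod_lin (K : fieldType) (u : seq K) (P : pred K) (y : K) :
  (forall x, x \in u -> P x -> 1 - x * y != 0) ->
  y * (\prod_(x <- u | P x) lin x)^`().[y] / (\prod_(x <- u | P x) lin x).[y] =
  - \sum_(x <- u | P x) x * y / (1 - x * y).
Proof.
elim: u => [|x u IH] uP.
  by rewrite !big_nil -polyC1 derivC horner0 mulr0 mul0r oppr0.
have /IH {}IH x' : x' \in u -> P x' -> 1 - x' * y != 0.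
  by move=> x'u; apply: uP; rewrite inE x'u orbT.
rewrite !big_cons; case: ifP => // Px; rewrite opprD -IH.
have lx := lin_horner x y; have l0 := uP x (mem_head _ _) Px.
have l'x : (lin x)^`().[y] = - x by rewrite /lin !derivE !hornerE.
have p0 : (\prod_(x <- u | P x) lin x).[y] != 0.
  rewrite horner_prod prodf_seq_neq0; apply/allP => k ku; apply/implyP => Pk.
  by rewrite lin_horner uP // inE ku orbT.
rewrite derivM hornerD !hornerM l'x lx; move: (_.[y]) p0 => p p0.
by field; rewrite l0 p0.
Qed.

(** * Partial fractions with poles of order at most 2 *)

Section PartialFractions.
Variables (K : fieldType) (s : seq K).
Hypothesis s_neq0 : {in s, forall x, x != 0}.
Hypothesis s_count : forall x, (count_mem x s <= 2)%N.

Definition cofac (x : K) : {poly K} := \prod_(y <- s | y != x) lin y.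

Definition pf_coefB (x : K) : K := (cofac x).[x^-1]^-1.

(** This is -x^-1 times the derivative of 1 / [cofac x] at x^-1, that is, the coefficient of 1 - x t
    in the expansion of 1 / [cofac x] there, since t - x^-1 = -x^-1 (1 - x t). *)
Definition pf_coefA (x : K) : K :=
  x^-1 * (cofac x)^`().[x^-1] / (cofac x).[x^-1] ^+ 2.

Definition coef_pf (x : K) : {poly K} :=
  if count_mem x s == 2%N then pf_coefA x *: lin x + (pf_coefB x)%:P
  else (pf_coefB x)%:P.

Lemma lin_XsubC (x : K) : x != 0 -> lin x = - x *: ('X - (x^-1)%:P).
Proof.
move=> x0; rewrite scalerBr -(mul_polyC (- x) (x^-1)%:P) -polyCM mulNr mulfV //.
by rewrite polyCN polyC1 opprK addrC scaleNr.
Qed.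

Lemma lin_neq0 (x : K) : lin x != 0.
Proof. by apply: contraTneq (oner_neq0 K) => l0; rewrite -(lin0 x) l0 coef0 eqxx. Qed.

Lemma cofac_neq0 x : x != 0 -> (cofac x).[x^-1] != 0.
Proof.
move=> x0; rewrite horner_prod prodf_seq_neq0; apply/allP => y _.
apply/implyP; apply: contraNN; rewrite lin_horner subr_eq0 eq_sym.
by rewrite -(inj_eq (mulIf x0)) mulfVK // mul1r.
Qed.

Lemma prod_lin x :
  \prod_(y <- s) lin y = lin x ^+ count_mem x s * cofac x.
Proof.
rewrite (bigID (pred1 x)) /=; congr (_ * _); rewrite -big_filter.
rewrite -size_filter; elim: (s) => [|y u IH] /=; first by rewrite big_nil.
by case: eqP => [->|_] //=; rewrite big_cons IH exprS.
Qed.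

(** [coef_pf x] is the expansion of 1 / [cofac x] at x^-1 cut off at the order of the pole. At a
    double pole, both the value and the derivative of the difference vanish. *)
Lemma pf_dvd x : x \in s -> lin x ^+ count_mem x s %| 1 - coef_pf x * cofac x.
Proof.
move=> xs; have x0 := s_neq0 xs; have G0 := cofac_neq0 x0.
have lz : lin x %= 'X - (x^-1)%:P.
  by rewrite lin_XsubC // eqp_scale // oppr_eq0.
have lx : (lin x).[x^-1] = 0 by rewrite lin_horner mulfV // subrr.
have r1 p : p.[x^-1] = 0 -> lin x %| p.
  by move=> /eqP p0; rewrite (eqp_dvdl _ lz) dvdp_XsubCl.
have := s_count x; rewrite /coef_pf; case: eqP => [-> _|]; last first.
  case: count => [|[|[|k]]] // _ _; first by rewrite expr0 dvd1p.
  by apply: r1; rewrite !hornerE /pf_coefB mulVf // subrr.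
rewrite (_ : 1 - _ = 1 - pf_coefA x *: (lin x * cofac x) - pf_coefB x *: cofac x); last first.
  by rewrite mulrDl opprD addrA -scalerAl mul_polyC.
set P := _ - _; have Px : P.[x^-1] = 0.
  by rewrite /P; move: (lin x) lx => l lx; rewrite !hornerE lx /pf_coefB /=; field.
have P'x : P^`().[x^-1] = 0.
  have : (lin x)^`().[x^-1] = - x by rewrite /lin !derivE !hornerE.
  rewrite /P; move: (lin x) lx => l lx l'x; rewrite !derivE !hornerE lx l'x /=.
  by rewrite /pf_coefA /pf_coefB; field; rewrite G0 x0.
have /dvdpP[R PR] := r1 _ Px; rewrite PR expr2 dvdp_mul2r ?lin_neq0 //.
apply: r1; move: P'x; rewrite PR derivM hornerD !hornerM lx mulr0.
rewrite add0r /lin !derivE !hornerE => /eqP; rewrite mulf_eq0 => /orP[/eqP//|].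
by rewrite oppr_eq0 (negPf x0).
Qed.

Lemma prod_lin_dvd (u : seq K) (k : K -> nat) (P : {poly K}) : uniq u ->
  {in u, forall x, x != 0} -> {in u, forall x, lin x ^+ k x %| P} ->
  \prod_(x <- u) lin x ^+ k x %| P.
Proof.
elim: u => [|x u IH] /=; first by rewrite big_nil dvd1p.
case/andP=> xu uu u0 uP; rewrite big_cons Gauss_dvdp.
  rewrite uP ?mem_head //; apply: IH => // y yu; [apply: u0|apply: uP];
  by rewrite inE yu orbT.
apply: coprimep_expl; rewrite coprimep_sym lin_XsubC ?u0 ?mem_head //.
rewrite coprimepZr ?oppr_eq0 ?u0 ?mem_head // coprimep_XsubC /root horner_prod.
rewrite prodf_seq_neq0; apply/allP => y yu /=; rewrite horner_exp expf_neq0 //.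
rewrite lin_horner subr_eq0 eq_sym; apply: contraNneq xu => yx.
by rewrite -(mul1r x) -yx mulfVK // u0 ?mem_head.
Qed.

Lemma size_prod_lin (P : pred K) :
  size (\prod_(x <- s | P x) lin x) = (count P s).+1.
Proof.
rewrite -big_filter size_prod_seq => [|x _]; last exact: lin_neq0.
rewrite -size_filter (eq_big_seq (fun=> 2%N)).
  rewrite big_const_seq count_predT iter_addn addn0.
  by rewrite mul2n -addnn -addSn addnK.
move=> x; rewrite mem_filter => /andP[_ /s_neq0 x0].
by rewrite lin_XsubC // size_scale ?oppr_eq0 // size_XsubC.
Qed.

(** Modulo the full power of 1 - x t only the summand of x survives, because every other cofactor
    contains that power. So the difference of the two sides is divisible by the whole product, but
    its degree is smaller. *)
Lemma partial_fractions : s != [::] ->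
  1 = \sum_(x <- undup s) coef_pf x * cofac x.
Proof.
move=> s0; apply/eqP; rewrite -subr_eq0; set P := _ - _.
have dP : \prod_(x <- s) lin x %| P.
  rewrite -(prodr_undup_exp_count s predT); apply: prod_lin_dvd => [|x|x].
  - exact: undup_uniq.
  - by rewrite mem_undup; apply: s_neq0.
  rewrite mem_undup => xs; rewrite /P (bigD1_seq x) ?mem_undup ?undup_uniq //=.
  rewrite opprD addrA dvdp_sub ?pf_dvd //.
  apply: (big_ind (dvdp (lin x ^+ count_mem x s))) => [|p q|y yx].
  - exact: dvdp0.
  - exact: dvdp_add.
  apply: dvdp_mull; rewrite /cofac -(prodr_undup_exp_count s (fun z => z != y)).
  by rewrite (big_rem x) ?mem_undup //= eq_sym yx dvdp_mulr.
(* The product has degree [size s]. A cofactor lacks as many factors as the multiplicity of x, and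
   the numerator has degree below that multiplicity. The constant 1 is small enough as s is
   nonempty. *)
apply: contraTT dP => /dvdp_leq P0; apply/negP => /P0; apply/negP.
rewrite -ltnNge size_prod_lin count_predT ltnS; apply: leq_trans (size_polyD _ _) _.
rewrite geq_max size_poly1 size_polyN lt0n size_eq0 s0 /=.
apply: leq_trans (size_sum _ _ _) _; apply/bigmax_leqP_seq => x.
rewrite mem_undup => xs _; apply: leq_trans (size_polyMleq _ _) _.
rewrite size_prod_lin addnS /= -(count_predC (pred1 x) s) leq_add2r.
rewrite /coef_pf; have := s_count x.
have : (0 < count_mem x s)%N by rewrite -has_count has_pred1.
case: eqP => [-> _ _|_ c0 _]; last by apply: leq_trans (size_polyC_leq1 _) _.
apply: leq_trans (size_polyD _ _) _; rewrite geq_max (leq_trans (size_polyC_leq1 _)) // andbT.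
apply: leq_trans (size_scale_leq _ _) _.
by rewrite lin_XsubC ?s_neq0 // size_scale ?oppr_eq0 ?s_neq0 // size_XsubC.
Qed.

Theorem taylor_coef_partial_fractions n : s != [::] ->
  taylor_coef 1 (\prod_(y <- s) lin y) n =
  \sum_(x <- undup s)
    (if count_mem x s == 2%N then pf_coefA x + pf_coefB x *+ n.+1 else pf_coefB x)
    * x ^+ n.
Proof.
move=> s0; rewrite [X in taylor_coef X](partial_fractions s0) taylor_coef_sum.
apply: eq_big_seq => x; rewrite mem_undup => xs.
have G0 : (cofac x)`_0 != 0 by rewrite coef_prod_lin oner_eq0.
have l0 k : (lin x ^+ k)`_0 != 0.
  by elim: k => [|k IH]; rewrite ?coef1 ?oner_eq0 // exprS coefM big_ord1 mulf_neq0 // lin0 oner_eq0.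
rewrite (prod_lin x) mulrC [_ ^+ _ * _]mulrC taylor_coef_mul // /coef_pf.
have := s_count x; have : (0 < count_mem x s)%N by rewrite -has_count has_pred1.
case: eqP => [-> _ _|]; first exact: taylor_coef_lin2.
by case: count => [|[|[|k]]] // _ _ _; rewrite expr1 taylor_coef_lin.
Qed.

End PartialFractions.

(** * Laurent expansions at z = 0 *)

Local Notation "p %:F" := (@FracField.tofrac _ p) (at level 1, format "p %:F").
(** Both sides are -x^(e+1) / (1 - x^(e+1)); one factor x is split off to exhibit the zero at x =
    0. *)
Lemma inv_1subXN (K : fieldType) (x : K) (e : nat) :
  x != 0 -> 1 - x ^+ e.+1 != 0 ->
  (1 - x ^ (- e.+1%:Z))^-1 = x * - (x ^+ e * (1 - x ^+ e.+1)^-1).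
Proof.
move=> x0; rewrite mulrN mulrA -exprS -exprnN.
have := expf_neq0 e.+1 x0; move: (x ^+ e.+1) => a a0 a1; field.
by rewrite a0 a1 -oppr_eq0 opprB.
Qed.

Lemma expfz_sub1 (K : fieldType) (x : K) (a b : int) :
  x != 0 -> x ^ a = x ^ b -> x ^ (a - b) = 1.
Proof.
by move=> x0 ab; rewrite expfzDr // ab -expfzDr // subrr expr0z.
Qed.

Section Laurent.
Variable F : fieldType.
Implicit Types (f g : ratfun F) (p q : {poly F}).
Notation z := (zvar F).

Lemma ratfunP f : exists p q v, q`_0 != 0 /\ f = p%:F / (q * 'X^v)%:F.
Proof.
set b := denom f; set v := mup 0 b; exists (numer f), (b %/ 'X^v), v.
have b0 : b != 0 by apply: denom_neq0.
have bE : b %/ 'X^v * 'X^v = b.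
  by rewrite divpK //; have := leqnn v; rewrite mup_geq // subr0.
split; last by rewrite bE -numer_denom.
apply: contraTneq (leqnn v) => c0; rewrite -ltnNge mup_geq // subr0 exprSr -bE.
rewrite mulrC dvdp_mul2r ?expf_neq0 ?polyX_eq0 //.
by rewrite -[X in X %| _]subr0 -polyC0 dvdp_XsubCl /root horner_coef0 c0.
Qed.

Lemma coef0_neq0 q : q`_0 != 0 -> q != 0.
Proof. by apply: contraNneq => ->; rewrite coef0. Qed.

Lemma coef0M p q : (p * q)`_0 = p`_0 * q`_0.
Proof. by rewrite coefM big_ord1. Qed.

Lemma laurentD f g m : laurent (f + g) m = laurent f m + laurent g m.
Proof.
have [p [q [v [q0 ->]]]] := ratfunP f; have [p' [q' [v' [q'0 ->]]]] := ratfunP g.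
have [n0 n0'] := (coef0_neq0 q0, coef0_neq0 q'0).
have nX k : 'X^k != 0 :> {poly F} by rewrite expf_neq0 ?polyX_eq0.
have qq0 : (q * q')`_0 != 0 by rewrite coef0M mulf_neq0.
have E1 : p%:F / (q * 'X^v)%:F = (p * q' * 'X^v')%:F / (q * q' * 'X^(v + v'))%:F.
  apply/eqP; rewrite eqr_div ?tofrac_eq0 ?mulf_neq0 // -!tofracM exprD.
  by apply/eqP; congr (_%:F); ring.
have E2 : p'%:F / (q' * 'X^v')%:F = (p' * q * 'X^v)%:F / (q * q' * 'X^(v + v'))%:F.
  apply/eqP; rewrite eqr_div ?tofrac_eq0 ?mulf_neq0 // -!tofracM exprD.
  by apply/eqP; congr (_%:F); ring.
rewrite E1 E2 -mulrDl -tofracD !laurentE //.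
by case: (m + _) => n; rewrite ?addr0 // taylor_coefD.
Qed.

Lemma laurentE0 p q m : q`_0 != 0 ->
  laurent (p%:F / q%:F) m = if m is Posz n then taylor_coef p q n else 0.
Proof. by move=> q0; have := laurentE p 0 m q0; rewrite mulr1 addr0. Qed.

Lemma laurent0 m : laurent (0 : ratfun F) m = 0.
Proof.
have -> : 0 = 0%:F / 1%:F :> ratfun F by rewrite tofrac0 mul0r.
rewrite laurentE0 ?coef1 ?oner_eq0 //.
by case: m => // n; rewrite taylor_coef0.
Qed.

Lemma laurent_sum (I : Type) (u : seq I) (P : pred I) (f : I -> ratfun F) m :
  laurent (\sum_(i <- u | P i) f i) m = \sum_(i <- u | P i) laurent (f i) m.
Proof.
by elim/big_rec2: _ => [|i x y _ <-]; rewrite ?laurent0 ?laurentD.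
Qed.

Lemma laurentMn f k m : laurent (f *+ k) m = laurent f m *+ k.
Proof. by elim: k => [|k IH]; rewrite ?laurent0 // !mulrS laurentD IH. Qed.

Lemma zvar_neq0 : z != 0.
Proof. by rewrite tofrac_eq0 polyX_eq0. Qed.

Lemma laurent_shiftn f (e : nat) m : laurent (f * z ^+ e) (m + e%:Z) = laurent f m.
Proof.
have [p [q [v [q0 ->]]]] := ratfunP f.
rewrite mulrAC -tofracXn -tofracM !laurentE //.
case E : (m + v%:Z) => [k|k]; rewrite (addrAC m e%:Z) E.
  by rewrite -PoszD taylor_coef_shift // ltnNge leq_addl addnK.
case E' : (Negz k + e%:Z) => [n|//]; rewrite taylor_coef_shift //.
suff -> : (n < e)%N by [].
lia.
Qed.

Lemma laurent_shift f (e m : int) : laurent (f * z ^ e) m = laurent f (m - e).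
Proof.
case: e => e.
  by rewrite -[in LHS](subrK e%:Z m) -exprnP laurent_shiftn.
rewrite -(laurent_shiftn (f * _) e.+1) NegzE opprK -exprnN mulfVK //.
by rewrite expf_neq0 // zvar_neq0.
Qed.

Lemma laurent_poly p (n : nat) : laurent p%:F n%:Z = p`_n.
Proof.
have -> : p%:F = p%:F / 1%:F by rewrite tofrac1 divr1.
rewrite laurentE0 ?coef1 ?oner_eq0 //.
by apply: taylor_coef_cong; rewrite ?coef1 ?oner_eq0 // mul1r subrr dvdp0.
Qed.

Definition regular0 f := exists p q, q`_0 != 0 /\ f = p%:F / q%:F.

Lemma regular0_laurent f m : regular0 f -> m < 0 -> laurent f m = 0.
Proof. by case=> p [q [q0 ->]]; rewrite laurentE0 //; case: m. Qed.

Lemma regular0_poly p : regular0 p%:F.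
Proof.
by exists p, 1; rewrite coef1 oner_eq0 tofrac1 divr1.
Qed.

Lemma regular0M f g : regular0 f -> regular0 g -> regular0 (f * g).
Proof.
move=> [p [q [q0 ->]]] [p' [q' [q'0 ->]]]; exists (p * p'), (q * q').
by rewrite coef0M mulf_neq0 // !tofracM mulf_div.
Qed.

Lemma regular0D f g : regular0 f -> regular0 g -> regular0 (f + g).
Proof.
move=> [p [q [q0 ->]]] [p' [q' [q'0 ->]]]; exists (p * q' + p' * q), (q * q').
rewrite coef0M mulf_neq0 //; split=> //.
by rewrite addf_div ?tofrac_eq0 ?coef0_neq0 // tofracD !tofracM.
Qed.

Lemma regular0N f : regular0 f -> regular0 (- f).
Proof.
by move=> [p [q [q0 ->]]]; exists (- p), q; rewrite q0 tofracN mulNr.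
Qed.

Lemma regular0_z e : regular0 (z ^+ e).
Proof. by rewrite -tofracXn; apply: regular0_poly. Qed.

Lemma regular0_inv e : (0 < e)%N -> regular0 (1 - z ^+ e)^-1.
Proof.
move=> e0; exists 1, (1 - 'X^e).
rewrite coefB coef1 coefXn (ltn_eqF e0) subr0 oner_eq0.
by rewrite tofracB tofracXn tofrac1 mul1r.
Qed.

Lemma z_neq1 (e : int) : e != 0 -> z ^ e != 1.
Proof.
have H (n : nat) : (0 < n)%N -> z ^+ n != 1.
  move=> n0; rewrite -tofracXn -tofrac1 tofrac_eq; apply/eqP => /(congr1 (fun p : {poly F} => p`_0)).
  by rewrite coefXn coef1 (ltn_eqF n0) => /esym/eqP; rewrite oner_eq0.
case: e => [[|e]|e] // _; first exact: H.
by rewrite NegzE -exprnN invr_eq1 H.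
Qed.

Lemma zexp_inj : injective (fun e : int => z ^ e).
Proof.
move=> a b /= ab; apply/eqP; rewrite -subr_eq0; apply: contraT => /z_neq1.
by rewrite (expfz_sub1 zvar_neq0 ab) eqxx.
Qed.

Lemma inv_1subzN (e : nat) :
  (1 - z ^ (- e.+1%:Z))^-1 = z * - (z ^+ e * (1 - z ^+ e.+1)^-1).
Proof.
apply: inv_1subXN; first exact: zvar_neq0.
by rewrite subr_eq0 eq_sym (z_neq1 (e := e.+1)).
Qed.

End Laurent.

(** * Residues of F(t, z) *)

Section RatLim.
Variables (K : fieldType) (s : seq K).

(** The power of 1 - x t cancels exactly the factors vanishing at x^-1, so the limits become
    evaluations of 1 / [cofac s x] and of its derivative. *)
Lemma rat_pole (x : K) :
  (\prod_(y <- s) lin y)%:F^-1 * (lin x)%:F ^+ count_mem x s = 1%:F / (cofac s x)%:F.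
Proof.
rewrite (prod_lin s x) tofracM tofracXn invfM mulrC mulrA mulfV ?tofrac1 //.
by rewrite expf_neq0 // tofrac_eq0 lin_neq0.
Qed.

Lemma rat_lim_pole (x : K) : x != 0 ->
  rat_lim ((\prod_(y <- s) lin y)%:F^-1 * (lin x)%:F ^+ count_mem x s) x^-1
  = pf_coefB s x.
Proof.
by move=> x0; rewrite rat_pole rat_limE ?cofac_neq0 // hornerE mul1r.
Qed.

Lemma rat_lim_deriv_pole (x : K) : x != 0 ->
  - x^-1 * rat_lim (rat_deriv
    ((\prod_(y <- s) lin y)%:F^-1 * (lin x)%:F ^+ count_mem x s)) x^-1
  = pf_coefA s x.
Proof.
move=> x0; have G0 := cofac_neq0 s x0; have g0 : cofac s x != 0.
  by apply: contraNneq G0 => ->; rewrite horner0.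
rewrite rat_pole rat_derivE // -polyC1 derivC mul0r sub0r.
rewrite rat_limE ?horner_exp ?expf_neq0 // polyC1 mul1r hornerN !mulNr.
by rewrite mulrN opprK mulrA.
Qed.

Lemma lin_tofrac (c w : K) (i : nat) :
  1 - ('X%:F * (c%:P)%:F) * (w%:P)%:F ^+ i = (lin (c * w ^+ i))%:F.
Proof.
rewrite /lin tofracB tofrac1 -mulrA -tofracXn -!tofracM -rmorphXn -polyCM.
by rewrite mulrC mul_polyC.
Qed.

Lemma lin_tofrac1 (c : K) : 1 - 'X%:F * (c%:P)%:F = (lin c)%:F.
Proof. by rewrite /lin tofracB tofrac1 -tofracM mulrC mul_polyC. Qed.

Lemma qpoch_lin_tofrac (c w : K) n m :
  (qpoch ('X%:F * (c%:P)%:F) (w%:P)%:F n * qpoch 'X%:F (w%:P)%:F m)^-1 =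
  (\prod_(0 <= i < n) lin (c * w ^+ i) * \prod_(0 <= j < m) lin (w ^+ j))%:F^-1.
Proof.
rewrite tofracM !rmorph_prod !big_mkord; congr (_ * _)^-1; apply: eq_bigr => i _.
  by rewrite /= -lin_tofrac.
by rewrite /= -[w ^+ i]mul1r -lin_tofrac polyC1 tofrac1 mulr1.
Qed.

End RatLim.

(** * q-Pochhammer products and closed forms of residues *)

Section QPochhammer.
Variables (K : fieldType) (z : K).
Hypothesis z0 : z != 0.

Lemma qpochE (c : int) n :
  \prod_(0 <= i < n) (1 - z ^ (c + 2 * i%:Z)) = qpoch (z ^ c) (z ^+ 2) n.
Proof.
rewrite /qpoch big_mkord; apply: eq_bigr => i _.
by rewrite expfzDr // -exprM exprnP PoszM.
Qed.

Lemma prod_zexp (c : int) n :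
  \prod_(0 <= i < n) (- z ^ (c + 2 * i%:Z)) =
  (-1) ^+ n * z ^ (n%:Z * (c + n%:Z - 1)).
Proof.
elim: n => [|n IH]; first by rewrite big_nil mul0r expr0z mulr1.
rewrite big_nat_recr //= IH exprS mulN1r mulrN mulNr -mulrA -expfzDr //.
by congr (- (_ * _ ^ _)); lia.
Qed.

(** Each factor is rewritten by 1 - z^m = -z^m (1 - z^(-m)), and the order of the factors is
    reversed. *)
Lemma qpoch_rev (c : int) n : qpoch (z ^ c) (z ^+ 2) n =
  (-1) ^+ n * z ^ (n%:Z * (c + n%:Z - 1))
  * qpoch (z ^ (2 - c - 2 * n%:Z)) (z ^+ 2) n.
Proof.
rewrite -!qpochE -prod_zexp [X in _ * X]big_nat_rev /= -big_split /=.
apply: eq_big_nat => i /andP[_ ni]; set m := c + _.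
rewrite [X in _ * (_ - _ ^ X)](_ : _ = - m); last by rewrite /m; lia.
by rewrite mulrBr mulr1 mulNr -expfzDr // subrr expr0z opprK addrC.
Qed.

(** The factors with i > a form (z^2, z^2)_(n-a); those with i < a have negative exponents and are
    reversed by [qpoch_rev]. *)
Lemma prod_diag n a : (a <= n)%N ->
  \prod_(0 <= i < n.+1 | i != a) (1 - z ^ (2 * i%:Z - 2 * a%:Z)) =
  (-1) ^+ a * z ^ (- (a%:Z * (a%:Z + 1)))
  * (qpoch (z ^+ 2) (z ^+ 2) a * qpoch (z ^+ 2) (z ^+ 2) (n - a)).
Proof.
move=> an; rewrite (big_cat_nat (leq0n a)) ?(leqW an) //= mulrA; congr (_ * _).
  rewrite big_nat_cond (eq_bigl (fun i => (0 <= i < a)%N && true)); last first.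
    by move=> i; case: ltngtP.
  rewrite -big_nat_cond (eq_bigr (fun i : nat => 1 - z ^ (- 2 * a%:Z + 2 * i%:Z))).
    rewrite qpochE qpoch_rev; congr (_ * _ ^ _ * qpoch _ _ _); first by lia.
    by rewrite exprnP; congr (_ ^ _); lia.
  by move=> i _; congr (1 - _ ^ _); lia.
rewrite big_ltn_cond ?ltnS // eqxx /= big_nat_cond.
rewrite (eq_bigl (fun i => (a.+1 <= i < n.+1)%N && true)); last first.
  by move=> i; case: ltngtP.
rewrite -big_nat_cond -[a.+1]add0n big_addn subSS -(qpochE 2); apply: eq_bigr => i _.
by congr (1 - _ ^ _); lia.
Qed.

Lemma inv_signed (a b : nat) (u v : int) (p q : K) :
  ((-1) ^+ a * z ^ u * p * ((-1) ^+ b * z ^ v * q))^-1 =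
  (-1) ^+ (a + b) * z ^ (- (u + v)) / (p * q).
Proof.
rewrite mulrACA [(-1) ^+ a * _ * _]mulrACA -exprD -expfzDr // invfM.
by rewrite [(_ * z ^ _)^-1]invfM invr_expz invr_sign.
Qed.

Lemma inv_signedr (b : nat) (v : int) (p q : K) :
  (p * ((-1) ^+ b * z ^ v * q))^-1 = (-1) ^+ b * z ^ (- v) / (p * q).
Proof.
by have := inv_signed 0 b 0 v p q; rewrite expr0 expr0z !mul1r add0n add0r.
Qed.

Lemma signr_eq (a b : nat) : odd a = odd b -> (-1) ^+ a = (-1) ^+ b :> K.
Proof. by move=> ab; rewrite -(signr_odd _ a) ab signr_odd. Qed.

(** The pole exponent d1 + d2 - 2k is the entry i = d1 - k of the first progression. The signs
    (-1)^(d1-k) and (-1)^(d2+1) combine to (-1)^k as d1 + d2 is odd. *)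
Lemma closed_form_A (d1 d2 k : nat) : (k <= d1)%N -> odd (d1 + d2) ->
  (\prod_(0 <= i < d1.+1 | i != (d1 - k)%N)
      (1 - z ^ (2 * i%:Z - 2 * (d1 - k)%N%:Z))
   * qpoch (z ^ (2 * k%:Z - d1%:Z - d2%:Z)) (z ^+ 2) d2.+1)^-1 =
  (-1) ^+ k * z ^ ((d1%:Z - k%:Z) * (d1%:Z - k%:Z + 1)
                   + (d2%:Z + 1) * (d1%:Z - 2 * k%:Z))
  / (qpoch (z ^+ 2) (z ^+ 2) k * qpoch (z ^+ 2) (z ^+ 2) (d1 - k)
     * qpoch (z ^ (d1%:Z - d2%:Z - 2 * k%:Z)) (z ^+ 2) d2.+1).
Proof.
move=> kd odd12; rewrite prod_diag ?leq_subr // qpoch_rev inv_signed subKn //.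
rewrite [qpoch _ _ (d1 - k) * _]mulrC; congr (_ * _ / (_ * qpoch (_ ^ _) _ _)).
- apply: signr_eq; move: odd12; rewrite !oddD oddB //= !addbN.
  by do 3 case: odd.
- by congr (_ ^ _); rewrite -subzn // intS; ring.
- by rewrite intS; ring.
Qed.

Lemma closed_form_B_lt (d1 d2 k : nat) : (2 * k < d2 - d1)%N -> 
  (qpoch (z ^ (d2%:Z - d1%:Z - 2 * k%:Z)) (z ^+ 2) d1.+1
   * \prod_(0 <= j < d2.+1 | j != k) (1 - z ^ (2 * j%:Z - 2 * k%:Z)))^-1 =
  (-1) ^+ k * z ^+ (k * (k + 1))
  / (qpoch (z ^+ (d2 - d1 - 2 * k)) (z ^+ 2) d1.+1
     * qpoch (z ^+ 2) (z ^+ 2) k * qpoch (z ^+ 2) (z ^+ 2) (d2 - k)).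
Proof.
move=> lt; rewrite prod_diag; last by lia.
rewrite inv_signedr opprK -(mulrA (qpoch _ _ d1.+1)).
congr (_ * _ / (qpoch _ _ _ * _)).
by rewrite exprnP; congr (_ ^ _); lia.
Qed.

(** The exponents -2s-1+2i of the first product are negative exactly for i <= s. Reversing these s +
    1 factors costs (-1)^(s+1) z^(-(s+1)^2), which supplies the square in the numerator. *)
Lemma closed_form_B_gt (d1 d2 k s : nat) :
  (2 * k = d2 - d1 + 2 * s + 1)%N -> (d1 <= d2)%N -> (s <= d1)%N -> (k <= d2)%N ->
  (qpoch (z ^ (d2%:Z - d1%:Z - 2 * k%:Z)) (z ^+ 2) d1.+1
   * \prod_(0 <= j < d2.+1 | j != k) (1 - z ^ (2 * j%:Z - 2 * k%:Z)))^-1 =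
  (-1) ^+ ((d2 - d1 - 1) %/ 2) * z ^+ (k * (k + 1) + (s + 1) ^ 2)
  / (qpoch z (z ^+ 2) s.+1 * qpoch z (z ^+ 2) (d1 - s)
     * qpoch (z ^+ 2) (z ^+ 2) k * qpoch (z ^+ 2) (z ^+ 2) (d2 - k)).
Proof.
move=> ks d12 sd kd; rewrite prod_diag //.
have -> : qpoch (z ^ (d2%:Z - d1%:Z - 2 * k%:Z)) (z ^+ 2) d1.+1 =
    (-1) ^+ s.+1 * z ^ (- ((s%:Z + 1) * (s%:Z + 1)))
    * (qpoch z (z ^+ 2) s.+1 * qpoch z (z ^+ 2) (d1 - s)).
  rewrite -qpochE (big_cat_nat (leq0n s.+1)) ?ltnS //= qpochE qpoch_rev -!mulrA.
  congr (_ * (_ ^ _ * (qpoch _ _ _ * _))); first by lia.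
    by rewrite -[RHS]expr1z; congr (_ ^ _); lia.
  rewrite -[s.+1]add0n big_addn subSS -{2}[z]expr1z -qpochE; apply: eq_bigr => i _.
  by congr (1 - _ ^ _); lia.
rewrite inv_signed [z ^+ (_ + _)]exprnP -!mulrA; congr (_ * (_ * _)).
  by apply: signr_eq; lia.
by congr (_ ^ _); rewrite PoszD PoszM -mulnn PoszM !PoszD; ring.
Qed.

End QPochhammer.

(** * The Poincare series *)

Lemma expfz_subn (K : fieldType) (x : K) (a b : nat) :
  x != 0 -> x ^ (a%:Z - b%:Z) = x ^+ a * (x ^+ b)^-1.
Proof. by move=> x0; rewrite expfzDr // -exprnN. Qed.

Lemma divr_1subV (K : fieldType) (a : K) :
  a != 0 -> 1 - a != 0 -> a^-1 / (1 - a^-1) = - (1 - a)^-1.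
Proof. by move=> a0 a1; field; rewrite a0 a1 -oppr_eq0 opprB. Qed.

Section PoincareSeries.
Variables (F : fieldType) (d1 d2 : nat).
Hypothesis char0 : forall k : nat, k.+1%:R != 0 :> F.
Hypothesis le_d1_d2 : (d1 <= d2)%N.
Notation r := (d1.+1 + d2.+1)%N.
Notation K := (ratfun F).
Notation z := (zvar F).

(* F(t, z) is the inverse of the product of the 1 - t z^e for e in pole_exps. *)
Definition exps1 : seq nat :=
  [seq (d2 - d1 + 2 * i)%N | i <- index_iota 0 d1.+1].

Definition exps2 : seq nat := [seq (2 * j)%N | j <- index_iota 0 d2.+1].

Definition pole_exps : seq nat := exps1 ++ exps2.

Definition poles : seq K := [seq z ^+ e | e <- pole_exps].

Definition t_exp (l : 'I_r) : nat :=
  match split l with inl i => d2 - d1 + 2 * i | inr j => 2 * j end.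

Lemma sl2_wtE l : sl2_wt l = d2%:Z - (t_exp l)%:Z.
Proof. by rewrite /sl2_wt /t_exp; case: split => i; lia. Qed.

Lemma prod_poles (T : comPzRingType) (G : nat -> T) :
  \prod_(e <- pole_exps) G e = \prod_l G (t_exp l).
Proof.
rewrite big_cat /exps1 /exps2 !big_map !big_mkord big_split_ord /=; congr (_ * _);
  by apply: eq_bigr => i _; rewrite /t_exp ?split_lshift ?split_rshift.
Qed.

Lemma PS_laurent n : PS F d1 d2 n =
  laurent ((1 + z) * taylor_coef 1 (\prod_(x <- poles) lin x) n) (n * d2)%:Z.
Proof.
rewrite big_map (prod_poles (fun e => lin (z ^+ e))) taylor_coef_prod_lin.
pose E (f : {ffun 'I_r -> 'I_n.+1}) := (\sum_l t_exp l * f l)%N.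
have -> : \sum_(f : {ffun 'I_r -> 'I_n.+1} | (\sum_l f l)%N == n)
    \prod_l (z ^+ t_exp l) ^+ f l =
    (\sum_(f : {ffun 'I_r -> 'I_n.+1} | (\sum_l f l)%N == n) 'X^(E f))%:F.
  rewrite rmorph_sum; apply: eq_bigr => f _; rewrite /= tofracXn -prodrXr.
  by apply: eq_bigr => l _; rewrite exprM.
have -> : 1 + z = (1 + 'X)%:F :> K by rewrite tofracD tofrac1.
rewrite -tofracM laurent_poly /PS (dim_semi_invariants _ _ _ char0).
rewrite mulr_sumr coef_sum -sum1_card natr_sum big_mkcond [RHS]big_mkcond /=.
apply: eq_bigr => f _; rewrite inE.
have -> : mdeg (mnm_of f) = (\sum_l f l)%N.
  by rewrite mdegE; apply: eq_bigr => l _; rewrite mnmE.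
have [fn|] := eqVneq _ n; rewrite ?andbF //=.
have -> : wt (@sl2_wt d1 d2) (mnm_of f) = (n * d2)%:Z - (E f)%:Z.
  rewrite /wt -[in RHS]fn big_distrl /= /E -[X in X - _]natz -[X in _ - X]natz.
  rewrite !natr_sum -sumrB; apply: eq_bigr => l _.
  by rewrite mnmE sl2_wtE -mulr_natr !natrM !natz; ring.
(* The monomial f gives z^(E f) + z^(E f + 1), which contains z^(n d2) exactly when the weight n d2
   - E f is 0 or 1. *)
rewrite mulrDl mul1r coefD -exprS !coefXn.
case: (eqVneq (n * d2)%N (E f)) => [->|ne].
  by rewrite subrr eqxx /= (ltn_eqF (ltnSn _)) addr0.
rewrite [X in X || _](_ : _ = false) ?add0r /=; last by apply/eqP; lia.
by rewrite (_ : (_ == 1) = (n * d2 == (E f).+1)%N); [case: eqP|apply/eqP/eqP; lia].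
Qed.

Lemma mem_pole_exps0 : 0%N \in pole_exps.
Proof.
by rewrite mem_cat; apply/orP; right; apply/mapP; exists 0%N.
Qed.

Lemma count_pole_exps e : (count_mem e pole_exps <= 2)%N.
Proof.
rewrite count_cat -[2%N]/(1 + 1)%N; apply: leq_add;
  rewrite count_uniq_mem ?leq_b1 // map_inj_uniq ?iota_uniq // => i j; lia.
Qed.

Lemma z_exp_inj : injective (fun e : nat => z ^+ e).
Proof. by move=> a b; rewrite !exprnP => /(@zexp_inj F)[]. Qed.

Lemma count_poles e : count_mem (z ^+ e) poles = count_mem e pole_exps.
Proof.
rewrite count_map; apply: eq_count => i /=; exact: (inj_eq z_exp_inj).
Qed.

Lemma count_poles_le2 x : (count_mem x poles <= 2)%N.
Proof.
have [/mapP[e _ ->]|/count_memPn-> //] := boolP (x \in poles).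
by rewrite count_poles count_pole_exps.
Qed.

Lemma poles_neq0 : {in poles, forall x, x != 0}.
Proof. by move=> _ /mapP[e _ ->]; rewrite expf_neq0 ?zvar_neq0. Qed.

(** Contribution of the pole t = z^(-e) to the n-th coefficient. The multiplicity n + 1 at a double
    pole is what becomes the derivative of z times a series in [pole_term_double]. *)
Definition pole_term (n e : nat) : F :=
  if count_mem e pole_exps == 2%N then
    phi1z (d2%:Z - e%:Z) (pf_coefA poles (z ^+ e)) n
    + phi1z (d2%:Z - e%:Z) (pf_coefB poles (z ^+ e)) n *+ n.+1
  else phi1z (d2%:Z - e%:Z) (pf_coefB poles (z ^+ e)) n.

Lemma PS_pole_terms n :
  PS F d1 d2 n = \sum_(e <- undup pole_exps) pole_term n e.
Proof.
rewrite PS_laurent (taylor_coef_partial_fractions poles_neq0 count_poles_le2) //.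
rewrite mulr_sumr laurent_sum /poles undup_map_inj; last exact: z_exp_inj.
rewrite big_map; apply: eq_bigr => e _; rewrite -/poles count_poles.
have E c : laurent ((1 + z) * (c * (z ^+ e) ^+ n)) (n * d2)%:Z =
    phi1z (d2%:Z - e%:Z) c n.
  rewrite mulrA -exprM exprnP laurent_shift /phi1z /phi; congr (laurent _ _).
  by rewrite mulrBr !PoszM mulrC [e%:Z * _]mulrC mulrC.
rewrite /pole_term; case: eqP => _ //.
by rewrite [X in _ * X]mulrDl mulrDr laurentD mulrnAl mulrnAr laurentMn !E.
Qed.

Lemma cofac_polesE (e : nat) : cofac poles (z ^+ e) =
  \prod_(e' <- pole_exps | e' != e) lin (z ^+ e').
Proof.
rewrite /cofac big_map; apply: eq_bigl => e'.
by rewrite (inj_eq z_exp_inj).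
Qed.

Lemma cofac_poles_horner (e : nat) : (cofac poles (z ^+ e)).[(z ^+ e)^-1] =
  \prod_(e' <- pole_exps | e' != e) (1 - z ^ (e'%:Z - e%:Z)).
Proof.
rewrite cofac_polesE horner_prod; apply: eq_bigr => e' _.
by rewrite lin_horner expfz_subn // zvar_neq0.
Qed.

Lemma regular0_inv_zdiff (e e' : nat) : e' != e ->
  regular0 (1 - z ^ (e'%:Z - e%:Z))^-1.
Proof.
move=> ee'; have [lt|lt] := ltnP e e'.
  rewrite subzn ?(ltnW lt) //. rewrite -exprnP. by apply: regular0_inv; rewrite subn_gt0.
have -> : e'%:Z - e%:Z = - ((e - e').-1.+1)%:Z by lia.
rewrite inv_1subzN; apply: (@regular0M F z); first exact: (regular0_z _ 1).
apply/regular0N/regular0M; [exact: regular0_z | exact: regular0_inv].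
Qed.

Lemma regular0_prod (I : eqType) (u : seq I) (P : pred I) (f : I -> K) :
  (forall i, P i -> regular0 (f i)) -> regular0 (\prod_(i <- u | P i) f i).
Proof.
move=> fP; elim/big_ind: _ => //; first exact: (regular0_z F 0).
exact: regular0M.
Qed.

(* The pole of F(t, z) at t = 1 makes the residues at t = z^(-e), e > 0,       *)
(* vanish at z = 0, so that phi_n of them is zero for n < 0.                   *)
Lemma pf_coefB_regular0 (e : nat) : (0 < e)%N ->
  exists2 g, regular0 g & pf_coefB poles (z ^+ e) = z * g.
Proof.
move=> e0; rewrite /pf_coefB cofac_poles_horner -prodfV.
rewrite (big_rem 0%N) ?mem_pole_exps0 //= eq_sym -lt0n e0 sub0r.
rewrite -[e]prednK // inv_1subzN prednK // -mulrA; eexists; last by [].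
apply: regular0M.
  by apply/regular0N/regular0M; [exact: regular0_z | exact: regular0_inv].
by apply: regular0_prod => i; apply: regular0_inv_zdiff.
Qed.

(** The terms of the logarithmic derivative are z^m / (1 - z^m) with m = e' - e; for m < 0 this
    equals -1 / (1 - z^(-m)), again without a pole at 0. *)
Lemma cofac_logderiv_regular0 (e : nat) :
  regular0 ((z ^+ e)^-1 * (cofac poles (z ^+ e))^`().[(z ^+ e)^-1]
            / (cofac poles (z ^+ e)).[(z ^+ e)^-1]).
Proof.
have z0 k : z ^+ k != 0 by rewrite expf_neq0 ?zvar_neq0.
have xy e' : z ^+ e' * (z ^+ e)^-1 = z ^ (e'%:Z - e%:Z).
  by rewrite expfz_subn ?zvar_neq0.
rewrite logderiv_prod_lin => [|_ /mapP[e' _ ->]]; last first.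
  rewrite (inj_eq z_exp_inj) xy => ee'.
  by rewrite subr_eq0 eq_sym z_neq1 // subr_eq0 eqz_nat.
apply: regular0N; rewrite big_map.
rewrite (eq_bigl (fun e' => e' != e)); last by move=> e'; rewrite (inj_eq z_exp_inj).
elim/big_ind: _ => [|f g|e' ee']; [exact: (regular0_poly 0) | exact: regular0D |].
rewrite xy; move: (ltnP e e') => [lt|le].
  rewrite subzn ?(ltnW lt) // -exprnP; apply: regular0M; first exact: regular0_z.
  by apply: regular0_inv; rewrite subn_gt0.
have lt : (e' < e)%N by rewrite ltn_neqAle ee'.
rewrite -opprB subzn // -exprnN divr_1subV //.
  by apply/regular0N/regular0_inv; rewrite subn_gt0.
by rewrite subr_eq0 eq_sym (z_neq1 F (e := (e - e')%:Z)) //; lia.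
Qed.

(** The coefficient read off has index n (d2 - e) <= 0, including n = 0, while both residue
    coefficients are z times a function regular at 0. *)
Lemma pole_term_eq0 n e : (d2 < e)%N -> pole_term n e = 0.
Proof.
move=> de; have e0 : (0 < e)%N by apply: leq_ltn_trans de.
have V g : regular0 g -> phi1z (d2%:Z - e%:Z) (z * g) n = 0.
  move=> gi; rewrite /phi1z /phi mulrCA [z * _]mulrC (laurent_shift _ 1).
  apply: regular0_laurent; last by nia.
  apply: regular0M => //; apply: regular0D; first exact: (regular0_z F 0).
  exact: (regular0_z F 1).
have [g gi Bg] := pf_coefB_regular0 e0.
rewrite /pole_term Bg V // mul0rn addr0; case: eqP => // _.
(* [pf_coefA] is [pf_coefB] times the logarithmic derivative of the cofactor, and so inherits the
   factor z. *)
rewrite /pf_coefA expr2 invfM mulrA -/(pf_coefB poles (z ^+ e)) Bg mulrCA V //.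
by apply: regular0M => //; rewrite -Bg; apply: cofac_logderiv_regular0.
Qed.

Lemma FtzE : Ftz F d1 d2 = ((\prod_(x <- poles) lin x)%:F)^-1.
Proof.
transitivity ((FracField.tofrac
  (\prod_(0 <= i < d1.+1) lin (z ^ (d2%:Z - d1%:Z) * (z ^ 2) ^+ i)
   * \prod_(0 <= j < d2.+1) lin ((z ^ 2) ^+ j)))^-1).
  exact: qpoch_lin_tofrac.
congr (FracField.tofrac _)^-1; rewrite big_map big_cat /exps1 /exps2 !big_map.
congr (_ * _); apply: eq_big_nat => i _; congr lin.
  by rewrite exprD subzn // exprM.
by rewrite exprM.
Qed.

Lemma zpow_lin (e : nat) : 1 - tvar F * zpow F e = FracField.tofrac (lin (z ^+ e)).
Proof. exact: (lin_tofrac1 (z ^ e)). Qed.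

Lemma zexp_neq0 (e : nat) : z ^+ e != 0.
Proof. by rewrite expf_neq0 ?zvar_neq0. Qed.

Lemma double_AE (e : nat) : count_mem e pole_exps = 2%N ->
  double_A F d1 d2 e = pf_coefA poles (z ^+ e).
Proof.
move=> c2; rewrite -(rat_lim_deriv_pole poles (zexp_neq0 e)) count_poles c2.
by rewrite -FtzE -zpow_lin /double_A -exprnN -exprnP.
Qed.

Lemma double_BE (e : nat) : count_mem e pole_exps = 2%N ->
  double_B F d1 d2 e = pf_coefB poles (z ^+ e).
Proof.
move=> c2; rewrite -(rat_lim_pole poles (zexp_neq0 e)) count_poles c2.
by rewrite -FtzE -zpow_lin /double_B -exprnN.
Qed.

Lemma simple_CE (e : nat) : count_mem e pole_exps = 1%N ->
  simple_C F d1 d2 e = pf_coefB poles (z ^+ e).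
Proof.
move=> c1; rewrite -(rat_lim_pole poles (zexp_neq0 e)) count_poles c1 expr1.
by rewrite -FtzE -zpow_lin /simple_C -exprnN.
Qed.

Lemma pole_term_double n (e : nat) : count_mem e pole_exps = 2%N ->
  pole_term n e =
  phi1z (d2%:Z - e%:Z) (double_A F d1 d2 e) n
  + ser_deriv (ser_mulz (phi1z (d2%:Z - e%:Z) (double_B F d1 d2 e))) n.
Proof.
move=> c2; rewrite /pole_term c2 eqxx double_AE // double_BE //.
by rewrite /ser_deriv /ser_mulz mulr_natl.
Qed.

Lemma pole_term_simple n (e : nat) : count_mem e pole_exps = 1%N ->
  pole_term n e = phi1z (d2%:Z - e%:Z) (simple_C F d1 d2 e) n.
Proof. by move=> c1; rewrite /pole_term c1 simple_CE. Qed.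

(** * The two progressions of exponents and the three cases *)

Lemma uniq_exps1 : uniq exps1.
Proof. by rewrite map_inj_uniq ?iota_uniq // => i j; lia. Qed.

Lemma uniq_exps2 : uniq exps2.
Proof. by rewrite map_inj_uniq ?iota_uniq // => i j; lia. Qed.

Lemma count_exps e : count_mem e pole_exps = ((e \in exps1) + (e \in exps2))%N.
Proof.
by rewrite /pole_exps count_cat !count_uniq_mem ?uniq_exps1 ?uniq_exps2.
Qed.

Lemma mem_exps1 e :
  (e \in exps1) = (d2 - d1 <= e <= d2 + d1)%N && ~~ odd (e + d2 - d1).
Proof.
apply/mapP/andP => [[k] | [le12 ev]].
  by rewrite mem_index_iota => /andP[_ id] ->; split; lia.
by exists ((e - (d2 - d1)) %/ 2)%N; rewrite ?mem_index_iota; lia.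
Qed.

Lemma mem_exps2 e : (e \in exps2) = (e <= 2 * d2)%N && ~~ odd e.
Proof.
apply/mapP/andP => [[k] | [le2 ev]].
  by rewrite mem_index_iota => /andP[_ id] ->; split; lia.
by exists (e %/ 2)%N; rewrite ?mem_index_iota; lia.
Qed.

(** Reindexed by i = d1 - k; the indices with 2k < d1 have exponent above d2 and drop out. *)
Lemma sum_exps1 n :
  \sum_(e <- exps1) pole_term n e =
  \sum_(0 <= k < d1.+1 | (d1 <= 2 * k)%N)
    pole_term n (d2 + d1 - 2 * k).
Proof.
rewrite big_map big_nat_rev /= [RHS]big_mkcond; apply: eq_big_nat => k kd.
have -> : (d2 - d1 + 2 * (0 + d1.+1 - k.+1) = d2 + d1 - 2 * k)%N by lia.
by case: ifPn => // kd1; rewrite pole_term_eq0 //; lia.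
Qed.

Lemma sum_exps2 n :
  \sum_(e <- exps2) pole_term n e =
  \sum_(0 <= k < (d2 %/ 2).+1) pole_term n (2 * k).
Proof.
rewrite big_map (big_cat_nat (n := (d2 %/ 2).+1)) //=; last by lia.
rewrite [X in _ + X]big_nat [X in _ + X]big1 ?addr0 // => k kd.
by rewrite pole_term_eq0 //; lia.
Qed.

Lemma sum_double n :
  (forall e, e \in exps1 -> e \in exps2) ->
  \sum_(e <- exps1) pole_term n e =
  \sum_(0 <= k < d1.+1 | (d1 <= 2 * k)%N)
    phi1z (2 * k%:Z - d1%:Z)
      (double_A F d1 d2 (d2%:Z + d1%:Z - 2 * k%:Z)) n
  + \sum_(0 <= k < d1.+1 | (d1 <= 2 * k)%N)
    ser_deriv (ser_mulz (phi1z (2 * k%:Z - d1%:Z)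
      (double_B F d1 d2 (d2%:Z + d1%:Z - 2 * k%:Z)))) n.
Proof.
move=> sub; rewrite sum_exps1 -big_split /= [LHS]big_nat_cond [RHS]big_nat_cond.
apply: eq_bigr => k /andP[/andP[_ kd] _].
have k1 : (d2 + d1 - 2 * k)%N \in exps1 by rewrite mem_exps1; lia.
rewrite pole_term_double ?count_exps ?k1 ?sub //.
have -> : d2%:Z - (d2 + d1 - 2 * k)%N%:Z = 2 * k%:Z - d1%:Z by lia.
by have -> : (d2 + d1 - 2 * k)%N%:Z = d2%:Z + d1%:Z - 2 * k%:Z by lia.
Qed.

(** For equal parities the first progression is contained in the second, so its members are the
    double poles and the remaining even exponents are the simple ones. *)
Lemma PS_even n : (d1 = d2 %[mod 2])%N ->
  PS F d1 d2 n =
  \sum_(e <- exps1) pole_term n e +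
  \sum_(e <- exps2 | e \notin exps1) pole_term n e.
Proof.
move=> par; rewrite PS_pole_terms //.
rewrite (perm_big exps2); last first.
  apply: uniq_perm; rewrite ?undup_uniq ?uniq_exps2 // => e.
  rewrite mem_undup mem_cat mem_exps1 mem_exps2; lia.
rewrite (bigID (mem exps1)) /= -big_filter; congr (_ + _).
apply: perm_big; apply: uniq_perm; rewrite ?filter_uniq ?uniq_exps2 ?uniq_exps1 //.
move=> e; rewrite mem_filter mem_exps1 mem_exps2; lia.
Qed.

Lemma simple_term n k : (k <= d2)%N -> (2 * k)%N \notin exps1 ->
  pole_term n (2 * k) =
  phi1z (d2%:Z - 2 * k%:Z) (simple_C F d1 d2 (2 * k%:Z)) n.
Proof.
move=> kd k1; rewrite pole_term_simple ?PoszM // count_exps (negPf k1) mem_exps2.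
by lia.
Qed.

Lemma PS_even_lt n : (d1 = d2 %[mod 2])%N ->
  PS F d1 d2 n =
        \sum_(0 <= k < d1.+1 | (d1 <= 2 * k)%N)
          phi1z (2 * k%:Z - d1%:Z)
            (double_A F d1 d2 (d2%:Z + d1%:Z - 2 * k%:Z)) n
        + \sum_(0 <= k < d1.+1 | (d1 <= 2 * k)%N)
          ser_deriv (ser_mulz (phi1z (2 * k%:Z - d1%:Z)
            (double_B F d1 d2 (d2%:Z + d1%:Z - 2 * k%:Z)))) n
        + \sum_(0 <= k < d2.+1 | (2 * k + 2 <= d2 - d1)%N)
          phi1z (d2%:Z - 2 * k%:Z) (simple_C F d1 d2 (2 * k%:Z)) n
        + \sum_(0 <= k < d2.+1 | (d1 + d2 + 2 <= 2 * k)%N)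
          phi1z (d2%:Z - 2 * k%:Z) (simple_C F d1 d2 (2 * k%:Z)) n.
Proof.
move=> par; rewrite PS_even // sum_double; last first.
  by move=> e; rewrite mem_exps1 mem_exps2; lia.
rewrite -[RHS]addrA; congr (_ + _).
(* An even exponent outside the first progression lies either below d2 - d1 or above d2 + d1. *)
rewrite /exps2 big_map (bigID (fun k => 2 * k + 2 <= d2 - d1)%N) /=; congr (_ + _);
  rewrite [LHS]big_nat_cond [RHS]big_nat_cond.
  apply: eq_big => [k|k /andP[/andP[_ kd] /andP[k1 _]]].
    by rewrite mem_exps1; lia.
  by rewrite simple_term //; lia.
apply: eq_big => [k|k /andP[/andP[_ kd] /andP[k1 _]]].
  by rewrite mem_exps1; lia.
by rewrite simple_term //; lia.
Qed.

Lemma PS_diag n : d1 = d2 ->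
  PS F d1 d2 n =
        \sum_(0 <= k < (d1 %/ 2).+1)
          phi1z (d1%:Z - 2 * k%:Z) (double_A F d1 d2 (2 * k%:Z)) n
        + \sum_(0 <= k < (d1 %/ 2).+1)
          ser_deriv (ser_mulz (phi1z (d1%:Z - 2 * k%:Z)
            (double_B F d1 d2 (2 * k%:Z)))) n.
Proof.
move=> dd; rewrite PS_even; last by rewrite dd.
rewrite [X in _ + X]big_seq_cond.
rewrite [X in _ + X]big_pred0 ?addr0 => [|e]; last first.
  by rewrite mem_exps1 mem_exps2; lia.
rewrite (perm_big exps2); last first.
  apply: uniq_perm; rewrite ?uniq_exps1 ?uniq_exps2 // => e.
  by rewrite mem_exps1 mem_exps2; lia.
rewrite sum_exps2 -big_split /=; have -> : (d1 %/ 2 = d2 %/ 2)%N by rewrite dd.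
have -> : d1%:Z = d2%:Z by rewrite dd.
apply: eq_big_nat => k kd.
rewrite pole_term_double ?PoszM // count_exps mem_exps1 mem_exps2.
by lia.
Qed.

Lemma cofac_exps e : (cofac poles (z ^+ e)).[(z ^+ e)^-1] =
  \prod_(0 <= i < d1.+1 | (d2 - d1 + 2 * i)%N != e)
    (1 - z ^ ((d2 - d1 + 2 * i)%N%:Z - e%:Z))
  * \prod_(0 <= j < d2.+1 | (2 * j)%N != e) (1 - z ^ ((2 * j)%N%:Z - e%:Z)).
Proof. by rewrite cofac_poles_horner big_cat /exps1 /exps2 !big_map. Qed.

Lemma AoddE k : (k <= d1)%N -> odd (d1 + d2) ->
  Aodd F d1 d2 k = pf_coefB poles (z ^+ (d2 + d1 - 2 * k)).
Proof.
move=> kd odd12; rewrite /pf_coefB cofac_exps /Aodd -closed_form_A ?zvar_neq0 //.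
congr (_ * _)^-1.
  rewrite [LHS]big_nat_cond [RHS]big_nat_cond; apply: eq_big => [i|i _]; first by lia.
  by congr (1 - _ ^ _); lia.
rewrite -qpochE ?zvar_neq0 // [RHS]big_mkcond; apply: eq_big_nat => j _.
(* By parity no exponent of the second progression equals the pole exponent, so no factor is left
   out. *)
by rewrite ifT; [congr (1 - _ ^ _); lia | lia].
Qed.

Lemma BoddE k : (k <= d2 %/ 2)%N -> odd (d1 + d2) ->
  Bodd F d1 d2 k = pf_coefB poles (z ^+ (2 * k)).
Proof.
move=> kd odd12; transitivity
  (qpoch (z ^ (d2%:Z - d1%:Z - 2 * k%:Z)) (z ^+ 2) d1.+1
   * \prod_(0 <= j < d2.+1 | j != k) (1 - z ^ (2 * j%:Z - 2 * k%:Z)))^-1.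
  rewrite /Bodd; case: ifPn => [lt|ge]; first by rewrite closed_form_B_lt ?zvar_neq0.
  by rewrite -closed_form_B_gt ?zvar_neq0 //; lia.
rewrite /pf_coefB cofac_exps; congr (_ * _)^-1; last first.
  by apply: eq_big => [j|j _]; [lia | congr (1 - _ ^ _); lia].
rewrite -qpochE ?zvar_neq0 // [RHS]big_mkcond; apply: eq_big_nat => j _.
by rewrite ifT; [congr (1 - _ ^ _); lia | lia].
Qed.

(** The first progression is odd and the second even, so every pole is simple and its residue is
    [Aodd] or [Bodd]. *)
Lemma PS_odd n : (d2 - d1 = 1 %[mod 2])%N ->
  PS F d1 d2 n =
        \sum_(0 <= k < d1.+1 | (d1 <= 2 * k)%N)
          phi1z (2 * k%:Z - d1%:Z) (Aodd F d1 d2 k) n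
        + \sum_(0 <= k < (d2 %/ 2).+1)
          phi1z (d2%:Z - 2 * k%:Z) (Bodd F d1 d2 k) n.
Proof.
move=> par; have odd12 : odd (d1 + d2) by lia.
rewrite PS_pole_terms // undup_id; last first.
  rewrite cat_uniq uniq_exps1 uniq_exps2 andbT; apply/hasPn => e.
  by rewrite mem_exps1 mem_exps2; lia.
have c1 e : e \in exps1 -> e \notin exps2 by rewrite mem_exps1 mem_exps2; lia.
rewrite big_cat sum_exps1 sum_exps2 /=; congr (_ + _).
  rewrite [LHS]big_nat_cond [RHS]big_nat_cond; apply: eq_bigr => k /andP[/andP[_ kd] _].
  have k1 : (d2 + d1 - 2 * k)%N \in exps1 by rewrite mem_exps1; lia.
  rewrite /pole_term count_exps k1 (negPf (c1 _ k1)) /= AoddE //.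
  by congr (phi1z _ _ _); lia.
apply: eq_big_nat => k kd; have k2 : (2 * k)%N \in exps2 by rewrite mem_exps2; lia.
have k1 : (2 * k)%N \notin exps1 by apply: contraL k2; apply: c1.
by rewrite /pole_term count_exps k2 (negPf k1) /= BoddE // PoszM.
Qed.

End PoincareSeries.

Theorem mainTheorem5 (R : realType) (d1 d2 : nat)
    (d1_gt0 : (0 < d1)%N) (le_d1_d2 : (d1 <= d2)%N) :
  let C : fieldType := R[i] in
  [/\ (* (a) *)
      (d1 < d2)%N -> (d2 - d1 = 1 %[mod 2])%N -> forall n : nat,
      PS C d1 d2 n =
        \sum_(0 <= k < d1.+1 | (d1 <= 2 * k)%N)
          phi1z (2 * k%:Z - d1%:Z) (Aodd C d1 d2 k) n
        + \sum_(0 <= k < (d2 %/ 2).+1)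
          phi1z (d2%:Z - 2 * k%:Z) (Bodd C d1 d2 k) n,
      (* (b) *)
      (d1 < d2)%N -> (d1 = d2 %[mod 2])%N -> forall n : nat,
      PS C d1 d2 n =
        \sum_(0 <= k < d1.+1 | (d1 <= 2 * k)%N)
          phi1z (2 * k%:Z - d1%:Z)
            (double_A C d1 d2 (d2%:Z + d1%:Z - 2 * k%:Z)) n
        + \sum_(0 <= k < d1.+1 | (d1 <= 2 * k)%N)
          ser_deriv (ser_mulz (phi1z (2 * k%:Z - d1%:Z)
            (double_B C d1 d2 (d2%:Z + d1%:Z - 2 * k%:Z)))) n
        + \sum_(0 <= k < d2.+1 | (2 * k + 2 <= d2 - d1)%N)
          phi1z (d2%:Z - 2 * k%:Z) (simple_C C d1 d2 (2 * k%:Z)) n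
        + \sum_(0 <= k < d2.+1 | (d1 + d2 + 2 <= 2 * k)%N)
          phi1z (d2%:Z - 2 * k%:Z) (simple_C C d1 d2 (2 * k%:Z)) n
    & (* (c) *)
      d1 = d2 -> forall n : nat,
      PS C d1 d2 n =
        \sum_(0 <= k < (d1 %/ 2).+1)
          phi1z (d1%:Z - 2 * k%:Z) (double_A C d1 d2 (2 * k%:Z)) n
        + \sum_(0 <= k < (d1 %/ 2).+1)
          ser_deriv (ser_mulz (phi1z (d1%:Z - 2 * k%:Z)
            (double_B C d1 d2 (2 * k%:Z)))) n ].
Proof.
move=> C; have char0 (k : nat) : k.+1%:R != 0 :> C by rewrite pnatr_eq0.
split=> [_ par n | _ par n | dd n].
- exact: PS_odd.
- exact: PS_even_lt.
- exact: PS_diag.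
Qed.
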